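(* Let $a_1>a_2>0$, let $\mathbf e_1,\mathbf e_2\in\mathbb R^3$ be orthogonal unit vectors, and put $c_j=a_j^2$, $y_j=a_j(x-c_jt)$ for $j=1,2$, $\psi=\ln\frac{a_1+a_2}{a_1-a_2}$, and $$\Delta=(a_1-a_2)^2\cosh(y_2+y_1)+(a_1+a_2)^2\cosh(y_2-y_1).$$ Define $$u_1(x,t)=(a_1^2-a_2^2)\,a_1\,\frac{(a_1-a_2)^2\cosh(2y_2+y_1)+(a_1+a_2)^2\cosh(2y_2-y_1)+2(5a_2^2-3a_1^2)\cosh y_1}{\Delta^2},$$ $$u_2(x,t)=(a_1^2-a_2^2)\,a_2\,\frac{(a_1-a_2)^2\cosh(y_2+2y_1)+(a_1+a_2)^2\cosh(y_2-2y_1)+2(5a_1^2-3a_2^2)\cosh y_2}{\Delta^2},$$ $$u_3(x,t)=4(a_1^2-a_2^2)^2\,\frac{(a_1-a_2)\sinh(y_1+y_2)+(a_1+a_2)\sinh(y_1-y_2)}{\Delta^2}.$$ Then $$\mathbf u(x,t)=u_1(x,t)\,\mathbf e_1+u_2(x,t)\,\mathbf e_2+u_3(x,t)\,(\mathbf e_1\times\mathbf e_2),\qquad x,t\in\mathbb R,$$ is a solution of the vector modified Korteweg-de Vries equation $$\partial_t \mathbf u+6\,\mathbf u\times\partial_x^2\mathbf u+6\big(\mathbf u\,\partial_x|\mathbf u|^2-|\mathbf u|^2\,\partial_x\mathbf u\big)+\partial_x^3\mathbf u=0 .$$ As $|t|\to\infty$ this solution splits into two non-interacting solitons, oriented in the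 orthogonal directions $\mathbf e_1$ and $\mathbf e_2$: $$\mathbf u(x,t)=\mathbf e_1\frac{a_1}{\cosh(y_1-\psi)}+\mathbf e_2\frac{a_2}{\cosh(y_2+\psi)},\qquad t\to-\infty,$$ $$\mathbf u(x,t)=\mathbf e_1\frac{a_1}{\cosh(y_1+\psi)}+\mathbf e_2\frac{a_2}{\cosh(y_2-\psi)},\qquad t\to\infty.$$ When $|t|\to0$ these solitons interact and form a three-component resulting impulse.
   Context: Here $\mathbf u(x,t)\in\mathbb R^3$, $\times$ is the vector (cross) product in $\mathbb R^3$ and $|\cdot|$ is the Euclidean norm. This is the (essentially three-component) two-soliton solution with orthogonal directions, written in suitably shifted coordinates $x,t$. The two large-time formulas are asymptotic representations, given without an error term or a specified mode of convergence.
   Formalization: In u_3 the term (a_1-a_2) sinh(y_1+y_2) takes a minus sign, since with the printed plus u does not solve the equation; the two asymptotic displays are interchanged: phases y_1+ψ, y_2-ψ as t→-∞ and y_1-ψ, y_2+ψ as t→∞. *)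

(* Defs.v *)
(* Stdlib reals with Coquelicot. *)
From Stdlib Require Import Reals.
From Coquelicot Require Import Coquelicot.
Open Scope R_scope.

(* R^3 as a normed module, so that [is_derive] applies to vector-valued
   functions; triples are ((v1, v2), v3). *)
Definition vec3 : NormedModule R_AbsRing :=
  prod_NormedModule R_AbsRing
    (prod_NormedModule R_AbsRing R_NormedModule R_NormedModule) R_NormedModule.

Definition dot (v w : vec3) : R :=
  let '((v1, v2), v3) := v in
  let '((w1, w2), w3) := w in
  v1 * w1 + v2 * w2 + v3 * w3.

Definition cross (v w : vec3) : vec3 :=
  let '((v1, v2), v3) := v in
  let '((w1, w2), w3) := w in
  ((v2 * w3 - v3 * w2, v3 * w1 - v1 * w3), v1 * w2 - v2 * w1).

Definition enorm (v : vec3) : R := sqrt (dot v v).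

(* Fields are functions of x first, then t.  A solution is a classical one:
   every derivative in the equation exists at every point; [nx] is the
   x-derivative of |u|^2. *)
Definition solves_vmKdV (u : R -> R -> vec3) : Prop :=
  exists (ut ux uxx uxxx : R -> R -> vec3) (nx : R -> R -> R),
    forall x t : R,
      is_derive (fun s => u x s) t (ut x t) /\
      is_derive (fun z => u z t) x (ux x t) /\
      is_derive (fun z => ux z t) x (uxx x t) /\
      is_derive (fun z => uxx z t) x (uxxx x t) /\
      is_derive (fun z => enorm (u z t) ^ 2) x (nx x t) /\
      plus (plus (plus (ut x t)
        (scal 6 (cross (u x t) (uxx x t))))
        (scal 6 (minus (scal (nx x t) (u x t)) (scal (enorm (u x t) ^ 2) (ux x t)))))
        (uxxx x t) = zero.

(* y_j = a_j (x - c_j t) with c_j = a_j^2 *)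
Definition yphase (a x t : R) : R := a * (x - a ^ 2 * t).

Definition psi (a1 a2 : R) : R := ln ((a1 + a2) / (a1 - a2)).

Definition Delta (a1 a2 x t : R) : R :=
  let y1 := yphase a1 x t in
  let y2 := yphase a2 x t in
  (a1 - a2) ^ 2 * cosh (y2 + y1) + (a1 + a2) ^ 2 * cosh (y2 - y1).

Definition u1 (a1 a2 x t : R) : R :=
  let y1 := yphase a1 x t in
  let y2 := yphase a2 x t in
  (a1 ^ 2 - a2 ^ 2) * a1 *
  (((a1 - a2) ^ 2 * cosh (2 * y2 + y1) + (a1 + a2) ^ 2 * cosh (2 * y2 - y1)
    + 2 * (5 * a2 ^ 2 - 3 * a1 ^ 2) * cosh y1) / Delta a1 a2 x t ^ 2).

Definition u2 (a1 a2 x t : R) : R :=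
  let y1 := yphase a1 x t in
  let y2 := yphase a2 x t in
  (a1 ^ 2 - a2 ^ 2) * a2 *
  (((a1 - a2) ^ 2 * cosh (y2 + 2 * y1) + (a1 + a2) ^ 2 * cosh (y2 - 2 * y1)
    + 2 * (5 * a1 ^ 2 - 3 * a2 ^ 2) * cosh y2) / Delta a1 a2 x t ^ 2).

(* The two hyperbolic sines enter with opposite signs.  With the sign + in
   front of (a1 - a2) sinh (y1 + y2) the field [usol] below does not solve the
   equation: for a1 = 2, a2 = 1 the left-hand side at x = t = 0 has the third
   component -4212/125. *)
Definition u3 (a1 a2 x t : R) : R :=
  let y1 := yphase a1 x t in
  let y2 := yphase a2 x t in
  4 * (a1 ^ 2 - a2 ^ 2) ^ 2 *
  ((- (a1 - a2) * sinh (y1 + y2) + (a1 + a2) * sinh (y1 - y2))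
   / Delta a1 a2 x t ^ 2).

Definition usol (a1 a2 : R) (e1 e2 : vec3) (x t : R) : vec3 :=
  plus (plus (scal (u1 a1 a2 x t) e1) (scal (u2 a1 a2 x t) e2))
       (scal (u3 a1 a2 x t) (cross e1 e2)).

Definition soliton (a s : R) (e : vec3) (x t : R) : vec3 :=
  scal (a / cosh (yphase a x t + s)) e.

(* The time filter F is [Rbar_locally m_infty] or [Rbar_locally p_infty]. *)
Definition vanishes_uniformly (F : (R -> Prop) -> Prop) (f : R -> R -> R) : Prop :=
  forall eps : posreal, F (fun t => forall x : R, Rabs (f x t) < eps).

(* Along F, the field u is asymptotically, uniformly in x, the superposition of
   two solutions v and w whose overlap tends to zero. *)
Definition splits_into (F : (R -> Prop) -> Prop) (u v w : R -> R -> vec3) : Prop :=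
  solves_vmKdV v /\ solves_vmKdV w /\
  vanishes_uniformly F (fun x t => enorm (v x t) * enorm (w x t)) /\
  vanishes_uniformly F (fun x t => enorm (minus (u x t) (plus (v x t) (w x t)))).

(* As t -> 0, the profile of u is localized in x and all three of its components
   in the frame e1, e2, e1 x e2 are simultaneously bounded away from zero
   somewhere, whereas a superposition of solitons directed along e1 and e2 has
   no component along e1 x e2. *)
Definition three_component_impulse_near_0 (e1 e2 : vec3) (u : R -> R -> vec3) : Prop :=
  exists m : R, 0 < m /\
    locally 0 (fun t : R =>
      is_lim (fun x => enorm (u x t)) p_infty 0 /\
      is_lim (fun x => enorm (u x t)) m_infty 0 /\
      exists x : R,
        m <= Rabs (dot (u x t) e1) /\
        m <= Rabs (dot (u x t) e2) /\
        m <= Rabs (dot (u x t) (cross e1 e2))).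

(* Main.v *)
Require Import Defs.
From Stdlib Require Import Reals Lra List FunctionalExtensionality.
From Coquelicot Require Import Coquelicot.
Open Scope R_scope.

(* In the orthonormal frame (e1, e2, e1 x e2) the equation is a system for the scalar
   components.  With p = e^y1 and q = e^y2 these are N_i / D^2, where N_i and D are
   polynomials in p and q, hence sums of exponentials on which every derivative acts
   diagonally.  Since |u|^2 = (ln D)_xx and the D''-terms of u x u_xx cancel, the system
   multiplied by D^5 is a polynomial identity.

   For the asymptotics, u1 and u2 are both multiples of one function [profile] of (y, z),
   even in (y, z), in which reversing the sign of z exchanges two coefficients.  It satisfies
   |profile| <= C / cosh y and converges, at rate e^z as z -> -oo, to a multiple of a shifted
   sech of y.  As y1 / a1 - y2 / a2 = - (a1^2 - a2^2) t, for large |t| one of the phases is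
   large, with the right sign, at every x, and the errors are exponentially small in |t|
   uniformly in x. *)

(** * Vectors in an orthonormal frame *)

Definition frame (e1 e2 : vec3) (a b c : R) : vec3 :=
  plus (plus (scal a e1) (scal b e2)) (scal c (cross e1 e2)).

Lemma vec3_ext (v w : vec3) :
  fst (fst v) = fst (fst w) -> snd (fst v) = snd (fst w) -> snd v = snd w -> v = w.
Proof. destruct v as [[? ?] ?], w as [[? ?] ?]; simpl; intros -> -> ->; reflexivity. Qed.

(** Vector identities become one real polynomial identity per coordinate. [lazy] unfolds the module
    operations down to the real ones, which stay opaque so that [ring] recognises them. *)
Ltac vec_ring :=
  repeat match goal with v : NormedModule.sort _ _ |- _ => destruct v as [[? ?] ?] end;
  try apply vec3_ext; match goal with |- ?a = ?b => change (@eq R a b) end;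
  lazy -[Rplus Rmult Ropp IZR]; ring.

Lemma enorm_ge_0 (v : vec3) : 0 <= enorm v.
Proof. apply sqrt_pos. Qed.

Lemma enorm_sqr (v : vec3) : enorm v ^ 2 = dot v v.
Proof.
  unfold enorm; rewrite pow2_sqrt; [reflexivity|].
  destruct v as [[v1 v2] v3]; simpl; nra.
Qed.

Lemma enorm_1_dot (v : vec3) : enorm v = 1 -> dot v v = 1.
Proof. intros H; rewrite <- enorm_sqr, H; ring. Qed.

Lemma dot_comm (v w : vec3) : dot v w = dot w v.
Proof. destruct v as [[v1 v2] v3], w as [[w1 w2] w3]; simpl; ring. Qed.

(** The triple product expansion. For orthonormal [e1], [e2], this lemma and the next complete the
    multiplication table of the frame: [e2] times [cross e1 e2] gives [e1], and [cross e1 e2] times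
    [e1] gives [e2]. *)
Lemma cross_cross_r (v w : vec3) :
  cross w (cross v w) = minus (scal (dot w w) v) (scal (dot v w) w).
Proof. vec_ring. Qed.

Lemma cross_cross_l (v w : vec3) :
  cross (cross v w) v = minus (scal (dot v v) w) (scal (dot v w) v).
Proof. vec_ring. Qed.

Lemma cross_frame (e1 e2 : vec3) (a b c a' b' c' : R) :
  dot e1 e1 = 1 -> dot e2 e2 = 1 -> dot e1 e2 = 0 ->
  cross (frame e1 e2 a b c) (frame e1 e2 a' b' c') =
  frame e1 e2 (b * c' - c * b') (c * a' - a * c') (a * b' - b * a').
Proof.
  intros h1 h2 h12.
  transitivity
    (plus (plus (scal (b * c' - c * b') (cross e2 (cross e1 e2)))
                (scal (c * a' - a * c') (cross (cross e1 e2) e1)))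
          (scal (a * b' - b * a') (cross e1 e2))).
  - clear h1 h2 h12; vec_ring.
  - rewrite cross_cross_r, cross_cross_l, h1, h2, h12.
    clear h1 h2 h12; vec_ring.
Qed.

Lemma dot_frame (e1 e2 : vec3) (a b c a' b' c' : R) :
  dot e1 e1 = 1 -> dot e2 e2 = 1 -> dot e1 e2 = 0 ->
  dot (frame e1 e2 a b c) (frame e1 e2 a' b' c') = a * a' + b * b' + c * c'.
Proof.
  intros h1 h2 h12.
  (* The coefficient of [c * c'] is the squared length of [cross e1 e2], written by Lagrange's
     identity. *)
  transitivity (a * a' * dot e1 e1 + b * b' * dot e2 e2 + (a * b' + b * a') * dot e1 e2
    + c * c' * (dot e1 e1 * dot e2 e2 - dot e1 e2 ^ 2)).
  - clear h1 h2 h12; vec_ring.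
  - rewrite h1, h2, h12; ring.
Qed.

Lemma dot_frame_basis (e1 e2 : vec3) (a b c : R) :
  dot e1 e1 = 1 -> dot e2 e2 = 1 -> dot e1 e2 = 0 ->
  dot (frame e1 e2 a b c) e1 = a /\ dot (frame e1 e2 a b c) e2 = b /\
  dot (frame e1 e2 a b c) (cross e1 e2) = c.
Proof.
  intros h1 h2 h12.
  split; [|split].
  - transitivity (a * dot e1 e1 + b * dot e1 e2); [clear h1 h2 h12; vec_ring|].
    rewrite h1, h12; ring.
  - transitivity (a * dot e1 e2 + b * dot e2 e2); [clear h1 h2 h12; vec_ring|].
    rewrite h2, h12; ring.
  - transitivity (c * (dot e1 e1 * dot e2 e2 - dot e1 e2 ^ 2)); [clear h1 h2 h12; vec_ring|].
    rewrite h1, h2, h12; ring.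
Qed.

Lemma frame_e1 (e1 e2 : vec3) a : scal a e1 = frame e1 e2 a 0 0.
Proof. vec_ring. Qed.

Lemma frame_e2 (e1 e2 : vec3) a : scal a e2 = frame e1 e2 0 a 0.
Proof. vec_ring. Qed.

Lemma plus_frame (e1 e2 : vec3) a b c a' b' c' :
  plus (frame e1 e2 a b c) (frame e1 e2 a' b' c') = frame e1 e2 (a + a') (b + b') (c + c').
Proof. vec_ring. Qed.

Lemma minus_frame (e1 e2 : vec3) a b c a' b' c' :
  minus (frame e1 e2 a b c) (frame e1 e2 a' b' c') = frame e1 e2 (a - a') (b - b') (c - c').
Proof. vec_ring. Qed.

Lemma scal_frame (e1 e2 : vec3) k a b c :
  scal k (frame e1 e2 a b c) = frame e1 e2 (k * a) (k * b) (k * c).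
Proof. vec_ring. Qed.

Lemma frame_0 (e1 e2 : vec3) : frame e1 e2 0 0 0 = zero.
Proof. vec_ring. Qed.

Lemma is_derive_frame (e1 e2 : vec3) (f g h : R -> R) (x f' g' h' : R) :
  is_derive f x f' -> is_derive g x g' -> is_derive h x h' ->
  is_derive (fun z => frame e1 e2 (f z) (g z) (h z)) x (frame e1 e2 f' g' h').
Proof.
  intros Hf Hg Hh; unfold frame.
  apply (@is_derive_plus R_AbsRing vec3); [apply (@is_derive_plus R_AbsRing vec3)|];
  apply (@is_derive_scal_l R_AbsRing vec3); assumption.
Qed.

(** Exactly the derivatives that occur in the equation: one in time and three in space. *)
Definition has_jet (f ft fx fxx fxxx : R -> R -> R) : Prop :=
  forall x t : R, is_derive (fun s : R => f x s) t (ft x t) /\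
    is_derive (fun z : R => f z t) x (fx x t) /\
    is_derive (fun z : R => fx z t) x (fxx x t) /\
    is_derive (fun z : R => fxx z t) x (fxxx x t).

(** Orthonormality turns the cross product and the norm into their coordinate formulas, so the
    equation splits into three scalar ones. The squared norm enters as a separate function [n], so
    that a convenient closed form can be supplied for it. *)
Lemma frame_solves_vmKdV (e1 e2 : vec3)
    (f ft fx fxx fxxx g gt gx gxx gxxx h ht hx hxx hxxx n nx : R -> R -> R) :
  dot e1 e1 = 1 -> dot e2 e2 = 1 -> dot e1 e2 = 0 ->
  has_jet f ft fx fxx fxxx -> has_jet g gt gx gxx gxxx -> has_jet h ht hx hxx hxxx ->
  (forall x t, f x t ^ 2 + g x t ^ 2 + h x t ^ 2 = n x t) ->
  (forall x t, is_derive (fun z => n z t) x (nx x t)) ->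
  (forall x t, ft x t + 6 * (g x t * hxx x t - h x t * gxx x t)
     + 6 * (nx x t * f x t - n x t * fx x t) + fxxx x t = 0) ->
  (forall x t, gt x t + 6 * (h x t * fxx x t - f x t * hxx x t)
     + 6 * (nx x t * g x t - n x t * gx x t) + gxxx x t = 0) ->
  (forall x t, ht x t + 6 * (f x t * gxx x t - g x t * fxx x t)
     + 6 * (nx x t * h x t - n x t * hx x t) + hxxx x t = 0) ->
  solves_vmKdV (fun x t => frame e1 e2 (f x t) (g x t) (h x t)).
Proof.
  intros h1 h2 h12 Jf Jg Jh En Dn E1 E2 E3.
  exists (fun x t => frame e1 e2 (ft x t) (gt x t) (ht x t)),
    (fun x t => frame e1 e2 (fx x t) (gx x t) (hx x t)),
    (fun x t => frame e1 e2 (fxx x t) (gxx x t) (hxx x t)),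
    (fun x t => frame e1 e2 (fxxx x t) (gxxx x t) (hxxx x t)), nx.
  assert (En' : forall x t, enorm (frame e1 e2 (f x t) (g x t) (h x t)) ^ 2 = n x t).
  { intros x t; rewrite enorm_sqr, dot_frame, <- En by assumption; ring. }
  intros x t.
  destruct (Jf x t) as (? & ? & ? & ?), (Jg x t) as (? & ? & ? & ?),
    (Jh x t) as (? & ? & ? & ?).
  do 4 (split; [apply is_derive_frame; assumption|]); split.
  - apply is_derive_ext with (fun z => n z t); [intros z; symmetry; apply En' | apply Dn].
  - rewrite En', cross_frame, !scal_frame, minus_frame, scal_frame, !plus_frame by assumption.
    rewrite <- (frame_0 e1 e2).
    f_equal; [apply E1 | apply E2 | apply E3].
Qed.

(** * Sums of exponentials of the phases *)

Fixpoint expsum (L : list (R * nat * nat)) (p q : R) : R :=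
  match L with
  | nil => 0
  | (c, k, l) :: L' => c * p ^ k * q ^ l + expsum L' p q
  end.

(** Each monomial p^k q^l is an eigenvector of differentiation with eigenvalue k al + l be. The pair
    (a1, a2) gives the x-derivative and (- a1^3, - a2^3) the t-derivative. *)
Fixpoint weigh (al be : R) (L : list (R * nat * nat)) : list (R * nat * nat) :=
  match L with
  | nil => nil
  | (c, k, l) :: L' => (c * (INR k * al + INR l * be), k, l) :: weigh al be L'
  end.

Lemma is_derive_expsum (L : list (R * nat * nat)) (P Q : R -> R) (al be x : R) :
  is_derive P x (al * P x) -> is_derive Q x (be * Q x) ->
  is_derive (fun z => expsum L (P z) (Q z)) x (expsum (weigh al be L) (P x) (Q x)).
Proof.
  intros HP HQ.
  induction L as [|[[c k] l] L IH]; simpl; [apply (@is_derive_const R_AbsRing R_NormedModule)|].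
  apply (@is_derive_plus R_AbsRing R_NormedModule); [|exact IH].
  (* The derivative of P is a multiple of P, which restores the exponent lowered by the power rule.
     For n = 0, where [pred 0] is 0, both sides vanish because of the factor [INR 0]. *)
  assert (pw : forall n y, INR n * y ^ pred n * y = INR n * y ^ n).
  { intros [|n] y; cbn [Nat.pred pow]; simpl (INR 0); ring. }
  evar_last.
  - apply is_derive_mult with (2 := is_derive_pow Q l x _ HQ); [|intros; apply Rmult_comm].
    apply is_derive_scal, is_derive_pow, HP.
  - cbn; rewrite !Rmult_plus_distr_l, !Rmult_plus_distr_r.
    transitivity (c * (INR k * P x ^ pred k * P x) * al * Q x ^ l
      + c * P x ^ k * (INR l * Q x ^ pred l * Q x) * be); [|rewrite !pw; ring].
    unfold plus, mult; simpl. ring.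
Qed.

(** * Jets of the phase exponentials and of quotients by powers *)

Definition phase_exp (a x t : R) : R := exp (yphase a x t).

Lemma is_derive_yphase_x (a x t : R) : is_derive (fun z => yphase a z t) x a.
Proof. unfold yphase; auto_derive; [trivial|ring]. Qed.

Lemma is_derive_yphase_t (a x t : R) : is_derive (fun s => yphase a x s) t (- a ^ 3).
Proof. unfold yphase; auto_derive; [trivial|ring]. Qed.

Lemma is_derive_phase_exp_x (a x t : R) :
  is_derive (fun z => phase_exp a z t) x (a * phase_exp a x t).
Proof.
  apply (is_derive_comp exp (fun z => yphase a z t)).
  - apply is_derive_exp.
  - apply is_derive_yphase_x.
Qed.

Lemma is_derive_phase_exp_t (a x t : R) :
  is_derive (fun s => phase_exp a x s) t (- a ^ 3 * phase_exp a x t).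
Proof.
  apply (is_derive_comp exp (fun s => yphase a x s)).
  - apply is_derive_exp.
  - apply is_derive_yphase_t.
Qed.

(** The quotient rule with the common power of [d] cancelled: each differentiation raises the
    exponent of the denominator by one only. *)
Lemma is_derive_div_pow (n d : R -> R) (x n1 d1 : R) (k : nat) :
  is_derive n x n1 -> is_derive d x d1 -> d x <> 0 ->
  is_derive (fun z => n z / d z ^ k) x ((n1 * d x - INR k * n x * d1) / d x ^ S k).
Proof.
  intros hn hd hd0.
  assert (pw : d x ^ k <> 0) by (apply pow_nonzero, hd0).
  evar_last.
  - apply is_derive_div; [exact hn | apply is_derive_pow, hd | exact pw].
  - destruct k as [|k]; cbn [Nat.pred pow] in *; [simpl; field; exact hd0|].
    assert (d x ^ k <> 0) by (apply pow_nonzero, hd0).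
    field; auto.
Qed.

(** Repeated use of the preceding quotient rule. In the first x-derivative a factor [d] has
    cancelled, hence the exponents 3, 4, 5. *)
Lemma has_jet_div_sqr (n nt n1 n2 n3 d dt d1 d2 d3 : R -> R -> R) :
  has_jet n nt n1 n2 n3 -> has_jet d dt d1 d2 d3 -> (forall x t, d x t <> 0) ->
  has_jet (fun x t => n x t / d x t ^ 2)
    (fun x t => (nt x t * d x t - 2 * n x t * dt x t) / d x t ^ 3)
    (fun x t => (n1 x t * d x t - 2 * n x t * d1 x t) / d x t ^ 3)
    (fun x t => (n2 x t * d x t ^ 2 - 4 * n1 x t * d1 x t * d x t
                 - 2 * n x t * d2 x t * d x t + 6 * n x t * d1 x t ^ 2) / d x t ^ 4)
    (fun x t => (n3 x t * d x t ^ 3 - 6 * n2 x t * d1 x t * d x t ^ 2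
                 - 6 * n1 x t * d2 x t * d x t ^ 2 + 18 * n1 x t * d1 x t ^ 2 * d x t
                 - 2 * n x t * d3 x t * d x t ^ 2 + 18 * n x t * d1 x t * d2 x t * d x t
                 - 24 * n x t * d1 x t ^ 3) / d x t ^ 5).
Proof.
  intros Jn Jd d0 x t.
  destruct (Jn x t) as (Hnt & Hn1 & Hn2 & Hn3), (Jd x t) as (Hdt & Hd1 & Hd2 & Hd3).
  specialize (d0 x t).
  split; [|split; [|split]].
  - evar_last; [exact (is_derive_div_pow _ _ _ _ _ 2 Hnt Hdt d0)|reflexivity].
  - evar_last; [exact (is_derive_div_pow _ _ _ _ _ 2 Hn1 Hd1 d0)|reflexivity].
  - evar_last.
    + apply (is_derive_div_pow
        (fun z => (n1 z t * d z t - 2 * n z t * d1 z t)) (fun z => d z t))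
        with (2 := Hd1); [|exact d0].
      auto_derive; [repeat split; eexists; eassumption | reflexivity].
    + rewrite (is_derive_unique _ _ _ Hn1), (is_derive_unique _ _ _ Hd1),
        (is_derive_unique _ _ _ Hn2), (is_derive_unique _ _ _ Hd2).
      cbn [INR]; field; exact d0.
  - evar_last.
    + apply (is_derive_div_pow
        (fun z => n2 z t * d z t ^ 2 - 4 * n1 z t * d1 z t * d z t
                  - 2 * n z t * d2 z t * d z t + 6 * n z t * d1 z t ^ 2)
        (fun z => d z t)) with (2 := Hd1); [|exact d0].
      auto_derive; [repeat split; eexists; eassumption | reflexivity].
    + rewrite (is_derive_unique _ _ _ Hn1), (is_derive_unique _ _ _ Hd1),
        (is_derive_unique _ _ _ Hn2), (is_derive_unique _ _ _ Hd2),
        (is_derive_unique _ _ _ Hn3), (is_derive_unique _ _ _ Hd3).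
      cbn [INR]; field; exact d0.
Qed.

Definition expsum_at (a1 a2 : R) (L : list (R * nat * nat)) (x t : R) : R :=
  expsum L (phase_exp a1 x t) (phase_exp a2 x t).

Lemma has_jet_expsum (a1 a2 : R) (L : list (R * nat * nat)) :
  has_jet (expsum_at a1 a2 L)
    (expsum_at a1 a2 (weigh (- a1 ^ 3) (- a2 ^ 3) L))
    (expsum_at a1 a2 (weigh a1 a2 L))
    (expsum_at a1 a2 (weigh a1 a2 (weigh a1 a2 L)))
    (expsum_at a1 a2 (weigh a1 a2 (weigh a1 a2 (weigh a1 a2 L)))).
Proof.
  intros x t; unfold expsum_at.
  split; [|split; [|split]];
    [apply (is_derive_expsum L (fun s => phase_exp a1 x s) (fun s => phase_exp a2 x s));
      apply is_derive_phase_exp_t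
    |apply (is_derive_expsum _ (fun z => phase_exp a1 z t) (fun z => phase_exp a2 z t));
      apply is_derive_phase_exp_x ..].
Qed.

(* [Delta] is multiplied by [2 p q] and the numerators of u1, u2, u3 by [4 p^2 q^2],
   where p = e^y1 and q = e^y2, which turns them into polynomials in p and q. *)
Definition den (a1 a2 : R) : list (R * nat * nat) :=
  ((a1 - a2) ^ 2, 2%nat, 2%nat) :: ((a1 - a2) ^ 2, 0%nat, 0%nat)
  :: ((a1 + a2) ^ 2, 2%nat, 0%nat) :: ((a1 + a2) ^ 2, 0%nat, 2%nat) :: nil.

Definition num1 (a1 a2 : R) : list (R * nat * nat) :=
  let k := 2 * (a1 ^ 2 - a2 ^ 2) * a1 in
  let m := 2 * (5 * a2 ^ 2 - 3 * a1 ^ 2) in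
  (k * (a1 - a2) ^ 2, 3%nat, 4%nat) :: (k * (a1 - a2) ^ 2, 1%nat, 0%nat)
  :: (k * (a1 + a2) ^ 2, 1%nat, 4%nat) :: (k * (a1 + a2) ^ 2, 3%nat, 0%nat)
  :: (k * m, 3%nat, 2%nat) :: (k * m, 1%nat, 2%nat) :: nil.

Definition num2 (a1 a2 : R) : list (R * nat * nat) :=
  let k := 2 * (a1 ^ 2 - a2 ^ 2) * a2 in
  let m := 2 * (5 * a1 ^ 2 - 3 * a2 ^ 2) in
  (k * (a1 - a2) ^ 2, 4%nat, 3%nat) :: (k * (a1 - a2) ^ 2, 0%nat, 1%nat)
  :: (k * (a1 + a2) ^ 2, 4%nat, 1%nat) :: (k * (a1 + a2) ^ 2, 0%nat, 3%nat)
  :: (k * m, 2%nat, 3%nat) :: (k * m, 2%nat, 1%nat) :: nil.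

Definition num3 (a1 a2 : R) : list (R * nat * nat) :=
  let k := 8 * (a1 ^ 2 - a2 ^ 2) ^ 2 in
  (- k * (a1 - a2), 3%nat, 3%nat) :: (k * (a1 - a2), 1%nat, 1%nat)
  :: (k * (a1 + a2), 3%nat, 1%nat) :: (- k * (a1 + a2), 1%nat, 3%nat) :: nil.

(** All four coefficients are squares of nonzero numbers, so the field has no singularities. *)
Lemma expsum_den_pos (a1 a2 x t : R) : 0 < a2 < a1 -> 0 < expsum_at a1 a2 (den a1 a2) x t.
Proof.
  intros H; unfold expsum_at, den, phase_exp, expsum.
  assert (P : forall c k l, 0 < c ->
    0 < c * exp (yphase a1 x t) ^ k * exp (yphase a2 x t) ^ l).
  { intros c k l hc; repeat apply Rmult_lt_0_compat; try apply pow_lt; auto using exp_pos. }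
  rewrite Rplus_0_r; repeat apply Rplus_lt_0_compat; apply P, pow_lt; lra.
Qed.

Lemma exp_double (y : R) : exp (2 * y) = exp y ^ 2.
Proof. replace (2 * y) with (y + y) by ring; rewrite exp_plus; ring. Qed.

Lemma Delta_expsum (a1 a2 x t : R) :
  Defs.Delta a1 a2 x t =
  expsum_at a1 a2 (den a1 a2) x t / (2 * phase_exp a1 x t * phase_exp a2 x t).
Proof.
  unfold Defs.Delta, expsum_at, phase_exp, cosh.
  unfold Rminus; rewrite ?Ropp_plus_distr, ?Ropp_involutive, ?exp_plus, ?exp_Ropp.
  assert (hp := exp_pos (yphase a1 x t)); assert (hq := exp_pos (yphase a2 x t)).
  cbv [expsum den]; field; split; apply Rgt_not_eq; assumption.
Qed.

Lemma usol_components_expsum (a1 a2 x t : R) : 0 < a2 < a1 ->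
  u1 a1 a2 x t = expsum_at a1 a2 (num1 a1 a2) x t / expsum_at a1 a2 (den a1 a2) x t ^ 2 /\
  u2 a1 a2 x t = expsum_at a1 a2 (num2 a1 a2) x t / expsum_at a1 a2 (den a1 a2) x t ^ 2 /\
  u3 a1 a2 x t = expsum_at a1 a2 (num3 a1 a2) x t / expsum_at a1 a2 (den a1 a2) x t ^ 2.
Proof.
  intros H; assert (hD := expsum_den_pos a1 a2 x t H).
  assert (hp := exp_pos (yphase a1 x t)); assert (hq := exp_pos (yphase a2 x t)).
  unfold u1, u2, u3; cbv zeta; rewrite Delta_expsum.
  revert hD; generalize (expsum_at a1 a2 (den a1 a2) x t); intros d hd.
  unfold expsum_at, phase_exp, cosh, sinh.
  unfold Rminus; rewrite ?Ropp_plus_distr, ?Ropp_involutive, ?exp_plus, ?exp_Ropp, ?exp_double.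
  revert hp hq; generalize (exp (yphase a1 x t)) (exp (yphase a2 x t)); intros p q hp hq.
  cbv [expsum num1 num2 num3].
  split; [|split]; field; repeat split; apply Rgt_not_eq; assumption.
Qed.

(** The differentiated function is the second logarithmic derivative (ln d)'', which will be the
    squared norm of the field. *)
Lemma is_derive_log_derivative2 (d d1 d2 : R -> R) (x d3 : R) :
  is_derive d x (d1 x) -> is_derive d1 x (d2 x) -> is_derive d2 x d3 -> d x <> 0 ->
  is_derive (fun z => (d z * d2 z - d1 z ^ 2) / d z ^ 2) x
    (((d x * d3 - d1 x * d2 x) * d x - 2 * (d x * d2 x - d1 x ^ 2) * d1 x) / d x ^ 3).
Proof.
  intros H1 H2 H3 d0; evar_last.
  - apply (is_derive_div_pow (fun z => d z * d2 z - d1 z ^ 2) d) with (2 := H1); [|exact d0].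
    auto_derive; [repeat split; eexists; eassumption | reflexivity].
  - replace (Derive (fun z => d z) x) with (d1 x) by (symmetry; apply is_derive_unique, H1).
    replace (Derive (fun z => d1 z) x) with (d2 x) by (symmetry; apply is_derive_unique, H2).
    replace (Derive (fun z => d2 z) x) with d3 by (symmetry; apply is_derive_unique, H3).
    cbn [INR]; field; exact d0.
Qed.

(** One component of the equation, cleared of d^5. In the cross product the terms with g h times
    [dxx] or [dx ^ 2] cancel by antisymmetry, and in the cubic part the terms with 2 f dx (d dxx -
    dx^2) cancel. Both remainders contain a spare factor [d], so d^5 suffices although some products
    have a higher power below. *)
Lemma vmKdV_component_div_sqr (f ft fx fxx fxxx g gx gxx h hx hxx d dt dx dxx dxxx : R) :
  d <> 0 ->
  (ft * d - 2 * f * dt) * d ^ 2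
  + 6 * ((g * hxx - h * gxx) * d - 4 * dx * (g * hx - h * gx))
  + 6 * (f * (d * dxxx - dx * dxx) - (d * dxx - dx ^ 2) * fx) * d
  + (fxxx * d ^ 3 - 6 * fxx * dx * d ^ 2
     - 6 * fx * dxx * d ^ 2 + 18 * fx * dx ^ 2 * d
     - 2 * f * dxxx * d ^ 2 + 18 * f * dx * dxx * d
     - 24 * f * dx ^ 3) = 0 ->
  (ft * d - 2 * f * dt) / d ^ 3
  + 6 * (g / d ^ 2 * ((hxx * d ^ 2 - 4 * hx * dx * d - 2 * h * dxx * d + 6 * h * dx ^ 2) / d ^ 4)
       - h / d ^ 2 * ((gxx * d ^ 2 - 4 * gx * dx * d - 2 * g * dxx * d + 6 * g * dx ^ 2) / d ^ 4))
  + 6 * (((d * dxxx - dx * dxx) * d - 2 * (d * dxx - dx ^ 2) * dx) / d ^ 3 * (f / d ^ 2)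
       - (d * dxx - dx ^ 2) / d ^ 2 * ((fx * d - 2 * f * dx) / d ^ 3))
  + (fxxx * d ^ 3 - 6 * fxx * dx * d ^ 2
     - 6 * fx * dxx * d ^ 2 + 18 * fx * dx ^ 2 * d
     - 2 * f * dxxx * d ^ 2 + 18 * f * dx * dxx * d
     - 24 * f * dx ^ 3) / d ^ 5 = 0.
Proof.
  intros hd E.
  match type of E with ?p = 0 => transitivity (p / d ^ 5) end.
  - field; exact hd.
  - rewrite E; field; exact hd.
Qed.

(** After differentiation has become arithmetic on coefficients, the two exponentials are replaced
    by independent variables, which leaves polynomial identities in a1, a2, p and q. *)
Ltac expand_expsum :=
  unfold expsum_at;
  match goal with |- context [phase_exp ?a1 ?x ?t] =>
    generalize (phase_exp a1 x t) end; intros p;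
  match goal with |- context [phase_exp ?a1 ?x ?t] =>
    generalize (phase_exp a1 x t) end; intros q;
  cbv [expsum weigh den num1 num2 num3 INR].

Lemma usol_frame (a1 a2 : R) (e1 e2 : vec3) (x t : R) :
  usol a1 a2 e1 e2 x t = frame e1 e2 (u1 a1 a2 x t) (u2 a1 a2 x t) (u3 a1 a2 x t).
Proof. reflexivity. Qed.

Lemma usol_expsum (a1 a2 : R) (e1 e2 : vec3) : 0 < a2 < a1 ->
  usol a1 a2 e1 e2 = fun x t => frame e1 e2
    (expsum_at a1 a2 (num1 a1 a2) x t / expsum_at a1 a2 (den a1 a2) x t ^ 2)
    (expsum_at a1 a2 (num2 a1 a2) x t / expsum_at a1 a2 (den a1 a2) x t ^ 2)
    (expsum_at a1 a2 (num3 a1 a2) x t / expsum_at a1 a2 (den a1 a2) x t ^ 2).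
Proof.
  intros ha; extensionality x; extensionality t.
  destruct (usol_components_expsum a1 a2 x t ha) as (E1 & E2 & E3).
  rewrite usol_frame, E1, E2, E3; reflexivity.
Qed.

Lemma usol_solves_vmKdV (a1 a2 : R) (e1 e2 : vec3) :
  0 < a2 < a1 -> dot e1 e1 = 1 -> dot e2 e2 = 1 -> dot e1 e2 = 0 ->
  solves_vmKdV (usol a1 a2 e1 e2).
Proof.
  intros ha h1 h2 h12; rewrite usol_expsum by exact ha.
  assert (d0 : forall x t, expsum_at a1 a2 (den a1 a2) x t <> 0).
  { intros x t; apply Rgt_not_eq, expsum_den_pos, ha. }
  pose proof (has_jet_expsum a1 a2 (den a1 a2)) as Jd.
  set (d := expsum_at a1 a2 (den a1 a2)) in *.
  set (dx := expsum_at a1 a2 (weigh a1 a2 (den a1 a2))) in *.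
  set (dxx := expsum_at a1 a2 (weigh a1 a2 (weigh a1 a2 (den a1 a2)))) in *.
  set (dxxx := expsum_at a1 a2 (weigh a1 a2 (weigh a1 a2 (weigh a1 a2 (den a1 a2))))) in *.
  eapply (frame_solves_vmKdV e1 e2) with
    (* The squared norm is taken as (ln D)_xx; the first remaining goal justifies this. *)
    (n := fun x t => (d x t * dxx x t - dx x t ^ 2) / d x t ^ 2)
    (nx := fun x t => ((d x t * dxxx x t - dx x t * dxx x t) * d x t
                       - 2 * (d x t * dxx x t - dx x t ^ 2) * dx x t) / d x t ^ 3);
    [exact h1 | exact h2 | exact h12
    | exact (has_jet_div_sqr _ _ _ _ _ _ _ _ _ _ (has_jet_expsum a1 a2 (num1 a1 a2)) Jd d0)
    | exact (has_jet_div_sqr _ _ _ _ _ _ _ _ _ _ (has_jet_expsum a1 a2 (num2 a1 a2)) Jd d0)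
    | exact (has_jet_div_sqr _ _ _ _ _ _ _ _ _ _ (has_jet_expsum a1 a2 (num3 a1 a2)) Jd d0)
    | | | | |]; intros x t; cbv beta.
  - specialize (d0 x t).
    match goal with |- (?f / ?d ^ 2) ^ 2 + (?g / _) ^ 2 + (?h / _) ^ 2 = ?m / _ =>
      (* The identity for the squared norm multiplied by D^4: N1^2 + N2^2 + N3^2 = (D D_xx - D_x^2)
         D^2. *)
      cut (f ^ 2 + g ^ 2 + h ^ 2 = m * d ^ 2) end.
    + intros E.
      match goal with |- (?f / ?d ^ 2) ^ 2 + (?g / _) ^ 2 + (?h / _) ^ 2 = ?m / _ =>
        transitivity ((f ^ 2 + g ^ 2 + h ^ 2) / d ^ 4); [field; exact d0 | rewrite E; field; exact d0] end.
    + subst d dx dxx dxxx; clear; expand_expsum. ring.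
  - destruct (Jd x t) as (_ & Hd1 & Hd2 & Hd3).
    apply (is_derive_log_derivative2 (fun z => d z t) (fun z => dx z t) (fun z => dxx z t));
      auto.
  - apply vmKdV_component_div_sqr; [apply d0|]. subst d dx dxx dxxx; clear; expand_expsum. ring.
  - apply vmKdV_component_div_sqr; [apply d0|]. subst d dx dxx dxxx; clear; expand_expsum. ring.
  - apply vmKdV_component_div_sqr; [apply d0|]. subst d dx dxx dxxx; clear; expand_expsum. ring.
Qed.

(** * Single solitons *)

Lemma cosh_pos (y : R) : 0 < cosh y.
Proof. unfold cosh; generalize (exp_pos y) (exp_pos (- y)); lra. Qed.

Lemma has_jet_sech (a s : R) :
  has_jet (fun x t => a / cosh (yphase a x t + s))
    (fun x t => a ^ 4 * sinh (yphase a x t + s) / cosh (yphase a x t + s) ^ 2)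
    (fun x t => - a ^ 2 * sinh (yphase a x t + s) / cosh (yphase a x t + s) ^ 2)
    (fun x t => a ^ 3 * (cosh (yphase a x t + s) ^ 2 - 2) / cosh (yphase a x t + s) ^ 3)
    (fun x t => a ^ 4 * sinh (yphase a x t + s) * (6 - cosh (yphase a x t + s) ^ 2)
                / cosh (yphase a x t + s) ^ 4).
Proof.
  intros x t.
  assert (c0 := Rgt_not_eq _ _ (cosh_pos (yphase a x t + s))).
  assert (E : sinh (yphase a x t + s) ^ 2 = cosh (yphase a x t + s) ^ 2 - 1).
  { unfold sinh, cosh; rewrite exp_Ropp; field; apply Rgt_not_eq, exp_pos. }
  assert (Dc : is_derive (fun z : R => cosh (yphase a z t + s)) x (a * sinh (yphase a x t + s))).
  { apply (is_derive_comp cosh (fun z => yphase a z t + s));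
      [apply is_derive_Reals, derivable_pt_lim_cosh|].
    unfold yphase; auto_derive; [trivial|ring]. }
  assert (Ds : is_derive (fun z : R => sinh (yphase a z t + s)) x (a * cosh (yphase a x t + s))).
  { apply (is_derive_comp sinh (fun z => yphase a z t + s));
      [apply is_derive_Reals, derivable_pt_lim_sinh|].
    unfold yphase; auto_derive; [trivial|ring]. }
  assert (Dt : is_derive (fun r : R => cosh (yphase a x r + s)) t
                (- a ^ 3 * sinh (yphase a x t + s))).
  { apply (is_derive_comp cosh (fun r => yphase a x r + s));
      [apply is_derive_Reals, derivable_pt_lim_cosh|].
    unfold yphase; auto_derive; [trivial|ring]. }
  split; [|split; [|split]].
  - evar_last; [apply (is_derive_div (fun _ => a) _ _ _ _ (is_derive_const a t) Dt c0)|].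
    unfold zero; simpl; field; exact c0.
  - evar_last; [apply (is_derive_div (fun _ => a) _ _ _ _ (is_derive_const a x) Dc c0)|].
    unfold zero; simpl; field; exact c0.
  - evar_last.
    + apply (is_derive_div_pow (fun z => - a ^ 2 * sinh (yphase a z t + s))) with (2 := Dc);
        [apply is_derive_scal, Ds | exact c0].
    (* Eliminating the square of sinh puts the second derivative in terms of cosh alone, which keeps
       the third one a short single fraction. *)
    + cbn [INR]; field_simplify; [|exact c0..]. rewrite E; field; exact c0.
  - evar_last.
    + apply (is_derive_div_pow (fun z => a ^ 3 * (cosh (yphase a z t + s) ^ 2 - 2))) with (2 := Dc);
        [|exact c0].
      apply is_derive_scal, (is_derive_minus (fun z => cosh (yphase a z t + s) ^ 2) (fun _ => 2));
        [apply is_derive_pow, Dc | apply is_derive_const].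
    + unfold minus, plus, opp, zero; simpl; field; exact c0.
Qed.

(** The vector [e'] completes [e] to an orthonormal frame. For a field of constant direction the
    cross product vanishes and the equation reduces to the scalar mKdV equation f_t + 6 f^2 f_x +
    f_xxx = 0, solved by a sech. *)
Lemma soliton_solves_vmKdV (a s : R) (e e' : vec3) :
  dot e e = 1 -> dot e' e' = 1 -> dot e e' = 0 -> solves_vmKdV (soliton a s e).
Proof.
  intros h1 h2 h12.
  assert (J0 : has_jet (fun _ _ => 0) (fun _ _ => 0) (fun _ _ => 0) (fun _ _ => 0) (fun _ _ => 0)).
  { intros x t; split; [|split; [|split]]; apply (@is_derive_const R_AbsRing R_NormedModule). }
  assert (S : solves_vmKdV (fun x t => frame e e' (a / cosh (yphase a x t + s)) 0 0)).
  { apply (frame_solves_vmKdV e e' _ _ _ _ _ _ _ _ _ _ _ _ _ _ _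
      (fun x t => (a / cosh (yphase a x t + s)) ^ 2)
      (fun x t => - 2 * a ^ 3 * sinh (yphase a x t + s) / cosh (yphase a x t + s) ^ 3)
      h1 h2 h12 (has_jet_sech a s) J0 J0); intros x t;
      assert (c0 := Rgt_not_eq _ _ (cosh_pos (yphase a x t + s))).
    - ring.
    - destruct (has_jet_sech a s x t) as (_ & H & _).
      evar_last; [apply is_derive_pow, H|].
      simpl; field; exact c0.
    - field; exact c0.
    - ring.
    - ring. }
  replace (soliton a s e) with (fun x t => frame e e' (a / cosh (yphase a x t + s)) 0 0);
    [exact S|].
  extensionality x; extensionality t; symmetry; apply frame_e1.
Qed.

(** * Large-time asymptotics *)

Definition profile (be si m y z : R) : R :=
  (be * cosh (2 * z + y) + si * cosh (2 * z - y) + m * cosh y)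
  / (be * cosh (z + y) + si * cosh (z - y)) ^ 2.

(** With w the denominator here, the numerator of [profile] behaves like w e^(-2z) / 2 as z -> -oo
    and its denominator like w^2 e^(-2z) / 4. *)
Definition limit_profile (be si y : R) : R := 2 / (be * exp (- y) + si * exp y).

Lemma cosh_opp (y : R) : cosh (- y) = cosh y.
Proof. unfold cosh; rewrite Ropp_involutive; field. Qed.

(** This reduces the limit z -> +oo to the limit z -> -oo with the two weights exchanged, which is
    what reverses the phase shift. *)
Lemma profile_flip (be si m y z : R) : profile be si m y (- z) = profile si be m y z.
Proof.
  unfold profile.
  rewrite <- (cosh_opp (2 * - z + y)), <- (cosh_opp (2 * - z - y)),
    <- (cosh_opp (- z + y)), <- (cosh_opp (- z - y)).
  replace (- (2 * - z + y)) with (2 * z - y) by ring.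
  replace (- (2 * - z - y)) with (2 * z + y) by ring.
  replace (- (- z + y)) with (z - y) by ring.
  replace (- (- z - y)) with (z + y) by ring.
  f_equal; [|f_equal]; ring.
Qed.

Lemma inv_cosh_le (y : R) : / cosh y <= 2 * exp y /\ / cosh y <= 2 * exp (- y).
Proof.
  assert (H1 := exp_pos y); assert (H2 := exp_pos (- y)).
  assert (E : exp y * exp (- y) = 1) by (rewrite <- exp_plus, Rplus_opp_r; apply exp_0).
  split; apply Rmult_le_reg_l with (cosh y); try apply cosh_pos;
    rewrite Rinv_r by apply Rgt_not_eq, cosh_pos; unfold cosh; nra.
Qed.

Lemma cosh_ge_1 (y : R) : 1 <= cosh y.
Proof. unfold cosh; generalize (exp_ineq1_le y) (exp_ineq1_le (- y)); lra. Qed.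

Lemma cosh_plus_minus (y z : R) : cosh (z + y) + cosh (z - y) = 2 * cosh z * cosh y.
Proof.
  unfold cosh, Rminus; rewrite !Ropp_plus_distr, !Ropp_involutive, !exp_plus; field.
Qed.

(** Replacing both weights by their sum or by their minimum leaves cosh (z + y) + cosh (z - y) = 2
    cosh z cosh y. *)
Lemma cosh_weighted_le (be si y z : R) :
  0 < be -> 0 < si ->
  be * cosh (z + y) + si * cosh (z - y) <= 2 * (be + si) * cosh z * cosh y /\
  2 * Rmin be si * cosh z * cosh y <= be * cosh (z + y) + si * cosh (z - y).
Proof.
  intros hb hs; generalize (cosh_pos (z + y)) (cosh_pos (z - y)) (cosh_plus_minus y z).
  intros; split.
  - replace (2 * (be + si) * cosh z * cosh y)
      with ((be + si) * (cosh (z + y) + cosh (z - y))) by (rewrite H1; ring).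
    nra.
  - replace (2 * Rmin be si * cosh z * cosh y)
      with (Rmin be si * (cosh (z + y) + cosh (z - y))) by (rewrite H1; ring).
    generalize (Rmin_l be si) (Rmin_r be si); nra.
Qed.

Lemma Rabs_div_le (a b A B : R) : Rabs a <= A -> 0 < B -> B <= b -> Rabs (a / b) <= A / B.
Proof.
  intros ha hB hb.
  unfold Rdiv; rewrite Rabs_mult, (Rabs_pos_eq (/ b)) by (apply Rlt_le, Rinv_0_lt_compat; lra).
  apply Rmult_le_compat; [apply Rabs_pos | apply Rlt_le, Rinv_0_lt_compat; lra | exact ha |].
  apply Rinv_le_contravar; lra.
Qed.

(** The numerator is O(cosh^2 z cosh y), since cosh 2z <= 2 cosh^2 z, and the denominator is at
    least (2 mu cosh z cosh y)^2; the dependence on z cancels. *)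
Lemma profile_bound (be si m : R) : 0 < be -> 0 < si ->
  exists C, 0 < C /\ forall y z, Rabs (profile be si m y z) <= C / cosh y.
Proof.
  intros hb hs.
  set (mu := Rmin be si); assert (hmu : 0 < mu) by (apply Rmin_glb_lt; assumption).
  exists ((4 * (be + si) + Rabs m) / (4 * mu ^ 2)); split.
  { apply Rdiv_lt_0_compat; [generalize (Rabs_pos m); lra | nra]. }
  intros y z; unfold profile.
  assert (hy := cosh_ge_1 y); assert (hz := cosh_ge_1 z).
  destruct (cosh_weighted_le be si y z hb hs) as [_ L]; fold mu in L.
  destruct (cosh_weighted_le be si y (2 * z) hb hs) as [U _].
  assert (E2 : cosh (2 * z) <= 2 * cosh z ^ 2).
  { assert (E := cosh_plus_minus z z); rewrite Rminus_diag_eq, cosh_0 in E by reflexivity.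
    replace (2 * z) with (z + z) by ring; nra. }
  assert (P1 := cosh_pos (2 * z + y)); assert (P2 := cosh_pos (2 * z - y)).
  eapply Rle_trans; [apply Rabs_div_le with
    (A := (4 * (be + si) + Rabs m) * cosh z ^ 2 * cosh y) (B := (2 * mu * cosh z * cosh y) ^ 2)|].
  - eapply Rle_trans; [apply Rabs_triang|].
    rewrite Rabs_pos_eq by nra; rewrite Rabs_mult, (Rabs_pos_eq (cosh y)) by lra.
    assert (A1 : (be + si) * cosh (2 * z) * cosh y <= (be + si) * (2 * cosh z ^ 2) * cosh y).
    { apply Rmult_le_compat_r; [lra|]; apply Rmult_le_compat_l; lra. }
    assert (A2 : Rabs m * cosh y <= Rabs m * cosh y * cosh z ^ 2).
    { assert (1 <= cosh z ^ 2) by nra.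
      assert (0 <= Rabs m * cosh y) by (apply Rmult_le_pos; [apply Rabs_pos | lra]). nra. }
    nra.
  - apply pow_lt; do 3 (apply Rmult_lt_0_compat; [|lra]); lra.
  - apply pow_incr; split; [|exact L]; do 3 (apply Rmult_le_pos; [|lra]); lra.
  - right; field; repeat split; lra.
Qed.

(* With q = e^z, w = be e^-y + si e^y and w' = be e^y + si e^-y the difference equals
   2 q^2 (q^2 w' (w - w') + 2 m w cosh y - 2 w w') / (w (w + q^2 w')^2). *)
Lemma profile_limit (be si m : R) : 0 < be -> 0 < si ->
  exists C, 0 < C /\ forall y z, z <= 0 ->
    Rabs (profile be si m y z - limit_profile be si y) <= C * exp z.
Proof.
  intros hb hs.
  set (mu := Rmin be si); assert (hmu : 0 < mu) by (apply Rmin_glb_lt; assumption).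
  exists ((24 * (be + si) ^ 2 + 4 * (be + si) * Rabs m) / (4 * mu ^ 3)); split.
  { apply Rdiv_lt_0_compat; [generalize (Rabs_pos m); nra | apply Rmult_lt_0_compat; [lra|]; apply pow_lt, hmu]. }
  intros y z hz.
  set (q := exp z).
  assert (hq : 0 < q) by apply exp_pos.
  assert (hq1 : q <= 1).
  { unfold q; rewrite <- exp_0; destruct hz as [hz | ->]; [left; apply exp_increasing, hz | right; reflexivity]. }
  set (w := be * exp (- y) + si * exp y); set (w' := be * exp y + si * exp (- y)).
  assert (hy := cosh_ge_1 y).
  assert (py := exp_pos y); assert (py' := exp_pos (- y)).
  assert (C2 : exp y + exp (- y) = 2 * cosh y) by (unfold cosh; field).
  assert (mb := Rmin_l be si); assert (ms := Rmin_r be si); fold mu in mb, ms.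
  assert (w1 : 2 * mu * cosh y <= w) by (unfold w; nra).
  assert (w2 : w <= 2 * (be + si) * cosh y) by (unfold w; nra).
  assert (w'1 : 0 <= w') by (unfold w'; nra).
  assert (w'2 : w' <= 2 * (be + si) * cosh y) by (unfold w'; nra).
  assert (w0 : 0 < w) by nra.
  assert (d0 : 0 < w + q ^ 2 * w') by nra.
  assert (E : profile be si m y z - limit_profile be si y =
    (2 * q ^ 2 * (q ^ 2 * (w' * (w - w')) + 2 * m * w * cosh y - 2 * (w * w')))
      / (w * (w + q ^ 2 * w') ^ 2)).
  { unfold profile, limit_profile; fold w.
    assert (N : be * cosh (2 * z + y) + si * cosh (2 * z - y) + m * cosh y
      = (q ^ 2 * w' + w / q ^ 2 + 2 * m * cosh y) / 2).
    { unfold w, w', q, cosh, Rminus.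
      rewrite !Ropp_plus_distr, !Ropp_involutive, !exp_plus, (exp_Ropp (2 * z)), exp_double.
      field; apply Rgt_not_eq, exp_pos. }
    assert (D : be * cosh (z + y) + si * cosh (z - y) = (q * w' + w / q) / 2).
    { unfold w, w', q, cosh, Rminus.
      rewrite !Ropp_plus_distr, !Ropp_involutive, !exp_plus, (exp_Ropp z).
      field; apply Rgt_not_eq, exp_pos. }
    rewrite N, D; clearbody w w' q; field; repeat split; nra. }
  rewrite E.
  eapply Rle_trans; [apply Rabs_div_le with
    (A := 2 * q * ((24 * (be + si) ^ 2 + 4 * (be + si) * Rabs m) * cosh y ^ 2))
    (* The denominator is at least w^3, and w is at least 2 mu cosh y. *)
    (B := (2 * mu * cosh y) ^ 3)|].
  - rewrite Rabs_mult, (Rabs_pos_eq (2 * q ^ 2)) by nra.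
    apply Rmult_le_compat; [nra | apply Rabs_pos | nra |].
    (* W bounds both w and w'. As q <= 1, the three terms of the bracket are at most W^2, 2 |m| W
       cosh y and 2 W^2, and the prefactor 2 q^2 is at most 2 q. *)
    set (W := 2 * (be + si) * cosh y) in *.
    assert (T1 : Rabs (q ^ 2 * (w' * (w - w'))) <= W ^ 2).
    { rewrite Rabs_mult, (Rabs_pos_eq (q ^ 2)) by nra.
      assert (Rabs (w' * (w - w')) <= W ^ 2) by (apply Rabs_le; nra).
      generalize (Rabs_pos (w' * (w - w'))); assert (q ^ 2 <= 1) by nra; nra. }
    assert (T2 : Rabs (2 * m * w * cosh y) <= 2 * Rabs m * W * cosh y).
    { rewrite !Rabs_mult, (Rabs_pos_eq 2), (Rabs_pos_eq w), (Rabs_pos_eq (cosh y)) by lra.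
      apply Rmult_le_compat_r; [lra|]; apply Rmult_le_compat_l; [generalize (Rabs_pos m)|]; lra. }
    assert (T3 : Rabs (2 * (w * w')) <= 2 * W ^ 2) by (rewrite Rabs_pos_eq; nra).
    replace ((24 * (be + si) ^ 2 + 4 * (be + si) * Rabs m) * cosh y ^ 2)
      with (6 * W ^ 2 + 2 * Rabs m * W * cosh y) by (unfold W; ring).
    unfold Rminus at 1; eapply Rle_trans; [apply Rabs_triang|]; rewrite Rabs_Ropp.
    eapply Rle_trans; [apply Rplus_le_compat_r, Rabs_triang|].
    assert (0 <= W ^ 2) by nra. lra.
  - apply pow_lt; nra.
  - replace ((2 * mu * cosh y) ^ 3) with (2 * mu * cosh y * (2 * mu * cosh y) ^ 2) by ring.
    apply Rmult_le_compat; [nra | apply pow2_ge_0 | exact w1 |].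
    apply pow_incr; split; nra.
  - apply Rle_trans with ((24 * (be + si) ^ 2 + 4 * (be + si) * Rabs m) / (4 * mu ^ 3) * q / cosh y).
    + right; field; split; lra.
    + rewrite <- (Rmult_1_r (_ * q)) at 2; apply Rmult_le_compat_l.
      * apply Rmult_le_pos; [|lra]; apply Rdiv_le_0_compat; [generalize (Rabs_pos m); nra | apply Rmult_lt_0_compat; [lra|]; apply pow_lt, hmu].
      * rewrite <- Rinv_1; apply Rinv_le_contravar; lra.
Qed.

Lemma inv_cosh_pos (y : R) : 0 < / cosh y.
Proof. apply Rinv_0_lt_compat, cosh_pos. Qed.

Lemma inv_cosh_le_1 (y : R) : / cosh y <= 1.
Proof. rewrite <- Rinv_1; apply Rinv_le_contravar; [lra | apply cosh_ge_1]. Qed.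

Lemma limit_profile_bound (be si : R) : 0 < be -> 0 < si ->
  exists C, 0 < C /\ forall y, Rabs (limit_profile be si y) <= C / cosh y.
Proof.
  intros hb hs.
  set (mu := Rmin be si); assert (hmu : 0 < mu) by (apply Rmin_glb_lt; assumption).
  exists (/ mu); split; [apply Rinv_0_lt_compat, hmu|]; intros y.
  assert (hy := cosh_pos y); assert (py := exp_pos y); assert (py' := exp_pos (- y)).
  assert (mb := Rmin_l be si); assert (ms := Rmin_r be si); fold mu in mb, ms.
  eapply Rle_trans; [apply Rabs_div_le with (A := 2) (B := 2 * mu * cosh y)|].
  - rewrite Rabs_pos_eq; lra.
  - nra.
  - unfold cosh; nra.
  - right; field; split; lra.
Qed.

(** If e^z is small, the profile is close to its limit; if y is large in absolute value, both are
    O(1 / cosh y) and hence small separately. *)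
Lemma profile_asymptotics (k be si m : R) : 0 < be -> 0 < si ->
  exists C, 0 < C /\ forall y z delta, delta <= 1 ->
    exp z <= delta \/ exp y <= delta \/ exp (- y) <= delta ->
    Rabs (k * profile be si m y z - k * limit_profile be si y) <= C * delta.
Proof.
  intros hb hs.
  destruct (profile_bound be si m hb hs) as (C1 & p1 & H1).
  destruct (limit_profile_bound be si hb hs) as (C2 & p2 & H2).
  destruct (profile_limit be si m hb hs) as (C3 & p3 & H3).
  assert (hk := Rabs_pos k).
  exists ((Rabs k + 1) * (2 * (C1 + C2) + C3)); split; [nra|].
  intros y z delta hd H.
  assert (F : Rabs (profile be si m y z - limit_profile be si y) <= (2 * (C1 + C2) + C3) * delta).
  { assert (Cy : / cosh y <= 2 * delta ->
      Rabs (profile be si m y z - limit_profile be si y) <= (2 * (C1 + C2) + C3) * delta).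
    { intros hc; generalize (H1 y z) (H2 y) (inv_cosh_pos y); intros G1 G2 G3.
      unfold Rminus, Rdiv in *; eapply Rle_trans; [apply Rabs_triang|]; rewrite Rabs_Ropp.
      nra. }
    destruct (inv_cosh_le y) as [I1 I2].
    destruct H as [H|[H|H]]; [|apply Cy; lra..].
    (* The bound [delta <= 1] provides the sign of z that [profile_limit] requires. *)
    assert (hz : z <= 0).
    { destruct (Rle_or_lt z 0) as [|hz]; [assumption|].
      apply exp_increasing in hz; rewrite exp_0 in hz; lra. }
    generalize (H3 y z hz) (exp_pos z); nra. }
  rewrite <- Rmult_minus_distr_l, Rabs_mult.
  generalize (Rabs_pos (profile be si m y z - limit_profile be si y)); nra.
Qed.

(** * The components of the field in terms of profiles *)

Lemma u1_profile (a1 a2 x t : R) :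
  u1 a1 a2 x t = (a1 ^ 2 - a2 ^ 2) * a1 *
    profile ((a1 - a2) ^ 2) ((a1 + a2) ^ 2) (2 * (5 * a2 ^ 2 - 3 * a1 ^ 2))
      (yphase a1 x t) (yphase a2 x t).
Proof. reflexivity. Qed.

Lemma u2_profile (a1 a2 x t : R) :
  u2 a1 a2 x t = (a1 ^ 2 - a2 ^ 2) * a2 *
    profile ((a1 - a2) ^ 2) ((a1 + a2) ^ 2) (2 * (5 * a1 ^ 2 - 3 * a2 ^ 2))
      (yphase a2 x t) (yphase a1 x t).
Proof.
  unfold u2, Defs.Delta, profile; cbv zeta.
  generalize (yphase a1 x t) (yphase a2 x t); intros y1 y2.
  rewrite <- (cosh_opp (y2 - 2 * y1)), <- (cosh_opp (y2 - y1)).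
  replace (- (y2 - 2 * y1)) with (2 * y1 - y2) by ring.
  replace (- (y2 - y1)) with (y1 - y2) by ring.
  rewrite (Rplus_comm y2 (2 * y1)), (Rplus_comm y2 y1); reflexivity.
Qed.

(** Since (a1 + a2)^2 = (a1^2 - a2^2) e^psi and (a1 - a2)^2 = (a1^2 - a2^2) e^(-psi), the limit
    denominator is 2 (a1^2 - a2^2) cosh (y + psi), or the same with - psi when the weights are
    exchanged. *)
Lemma limit_profile_soliton (a1 a2 a y : R) : 0 < a2 < a1 ->
  (a1 ^ 2 - a2 ^ 2) * a * limit_profile ((a1 - a2) ^ 2) ((a1 + a2) ^ 2) y
    = a / cosh (y + psi a1 a2) /\
  (a1 ^ 2 - a2 ^ 2) * a * limit_profile ((a1 + a2) ^ 2) ((a1 - a2) ^ 2) y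
    = a / cosh (y + - psi a1 a2).
Proof.
  intros h; unfold limit_profile, cosh.
  assert (E : exp (psi a1 a2) = (a1 + a2) / (a1 - a2)).
  { unfold psi; apply exp_ln, Rdiv_lt_0_compat; lra. }
  rewrite !Ropp_plus_distr, !Ropp_involutive, !exp_plus, !(exp_Ropp (psi a1 a2)), E, exp_Ropp.
  generalize (exp_pos y); generalize (exp y); intros p hp.
  assert (0 < (a1 - a2) ^ 2) by (apply pow_lt; lra).
  assert (0 < (a1 + a2) ^ 2) by (apply pow_lt; lra).
  split; field; repeat split; try lra; apply Rgt_not_eq; nra.
Qed.

(** As |sinh| <= cosh, the numerator is O(cosh y1 cosh y2), while [Delta] is at least 2 (a1 - a2)^2
    cosh y1 cosh y2. Hence the component decays like the product of both sech factors, and one large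
    phase makes it small. *)
Lemma u3_bound (a1 a2 : R) : 0 < a2 < a1 ->
  exists C, 0 < C /\ forall x t,
    Rabs (u3 a1 a2 x t) <= C / cosh (yphase a1 x t) /\
    Rabs (u3 a1 a2 x t) <= C / cosh (yphase a2 x t).
Proof.
  intros h.
  set (K := 4 * (a1 ^ 2 - a2 ^ 2) ^ 2).
  assert (hK : 0 <= K) by (unfold K; generalize (pow2_ge_0 (a1 ^ 2 - a2 ^ 2)); lra).
  set (b := a1 - a2); set (s := a1 + a2).
  assert (hb : 0 < b) by (unfold b; lra); assert (hs : b < s) by (unfold b, s; lra).
  exists (K * (2 * s / (4 * b ^ 4)) + 1); split.
  { assert (0 <= 2 * s / (4 * b ^ 4)).
    { apply Rdiv_le_0_compat; [lra|]; apply Rmult_lt_0_compat; [lra | apply pow_lt, hb]. }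
    nra. }
  intros x t.
  assert (M : Rabs (u3 a1 a2 x t) <=
    (K * (2 * s / (4 * b ^ 4)) + 1) * (/ cosh (yphase a1 x t) * / cosh (yphase a2 x t))).
  { unfold u3, Defs.Delta; cbv zeta; fold b; fold s; fold K.
    generalize (yphase a1 x t) (yphase a2 x t); intros y1 y2.
    assert (h1 := cosh_pos y1); assert (h2 := cosh_pos y2).
    assert (hb2 : 0 < b ^ 2) by (apply pow_lt, hb).
    assert (hs2 : 0 < s ^ 2) by (apply pow_lt; lra).
    destruct (cosh_weighted_le (b ^ 2) (s ^ 2) y1 y2 hb2 hs2) as [_ L].
    rewrite Rmin_left in L by nra.
    assert (S : forall y, Rabs (sinh y) <= cosh y).
    { intros y; unfold sinh, cosh; generalize (exp_pos y) (exp_pos (- y)).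
      intros; apply Rabs_le; lra. }
    assert (P : 0 < cosh y1 * cosh y2) by (apply Rmult_lt_0_compat; assumption).
    rewrite Rabs_mult, (Rabs_pos_eq K) by exact hK.
    apply Rle_trans with (K * (2 * s * (cosh y1 * cosh y2) / (2 * b ^ 2 * cosh y2 * cosh y1) ^ 2)).
    - apply Rmult_le_compat_l; [exact hK|]; apply Rabs_div_le.
      + assert (E := cosh_plus_minus y2 y1).
        eapply Rle_trans; [apply Rabs_triang|]; rewrite !Rabs_mult, Rabs_Ropp, (Rabs_pos_eq b), (Rabs_pos_eq s) by lra.
        replace (2 * s * (cosh y1 * cosh y2)) with (s * cosh (y1 + y2) + s * cosh (y1 - y2))
          by (rewrite <- Rmult_plus_distr_l, E; ring).
        apply Rplus_le_compat; apply Rmult_le_compat; try apply Rabs_pos; try apply S; lra.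
      + apply pow_lt; do 2 (apply Rmult_lt_0_compat; [|lra]); lra.
      + apply pow_incr; split; [|exact L]. do 2 (apply Rmult_le_pos; [|lra]); lra.
    - replace (K * (2 * s * (cosh y1 * cosh y2) / (2 * b ^ 2 * cosh y2 * cosh y1) ^ 2))
        with (K * (2 * s / (4 * b ^ 4)) * (/ cosh y1 * / cosh y2)) by (field; lra).
      apply Rmult_le_compat_r; [|lra].
      apply Rlt_le, Rmult_lt_0_compat; apply inv_cosh_pos. }
  assert (0 <= K * (2 * s / (4 * b ^ 4)) + 1).
  { assert (0 <= 2 * s / (4 * b ^ 4)).
    { apply Rdiv_le_0_compat; [lra|]; apply Rmult_lt_0_compat; [lra | apply pow_lt, hb]. }
    nra. }
  generalize (inv_cosh_pos (yphase a1 x t)) (inv_cosh_pos (yphase a2 x t))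
    (inv_cosh_le_1 (yphase a1 x t)) (inv_cosh_le_1 (yphase a2 x t)); intros.
  split; (eapply Rle_trans; [exact M|]); unfold Rdiv; apply Rmult_le_compat_l; nra.
Qed.

Lemma enorm_frame_le (e1 e2 : vec3) (a b c : R) :
  dot e1 e1 = 1 -> dot e2 e2 = 1 -> dot e1 e2 = 0 ->
  enorm (frame e1 e2 a b c) <= Rabs a + Rabs b + Rabs c.
Proof.
  intros h1 h2 h12; unfold enorm; rewrite dot_frame by assumption.
  assert (ha := Rabs_pos a); assert (hb := Rabs_pos b); assert (hc := Rabs_pos c).
  rewrite <- (sqrt_pow2 (Rabs a + Rabs b + Rabs c)) by lra.
  apply sqrt_le_1_alt.
  assert (S : forall r, r * r = Rabs r ^ 2) by (intros r; rewrite <- Rsqr_pow2, <- Rsqr_abs; reflexivity).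
  rewrite !S; nra.
Qed.

Lemma enorm_scal_unit (a : R) (e : vec3) : dot e e = 1 -> enorm (scal a e) = Rabs a.
Proof.
  intros h; unfold enorm.
  replace (dot (scal a e) (scal a e)) with (a ^ 2 * dot e e) by vec_ring.
  rewrite h, Rmult_1_r, <- Rsqr_pow2; apply sqrt_Rsqr_abs.
Qed.

(** * Uniform decay in time and separation of the phases *)

Lemma exp_decay (C k eps : R) : 0 < k -> 0 < eps ->
  exists M, 0 < M /\ forall r, M < r -> C * exp (- (k * r)) < eps.
Proof.
  intros hk he; assert (hC := Rabs_pos C).
  (* The threshold solves (|C| + 1) e^(-k r) = eps; adding 1 avoids a division by zero, and the
     maximum with 1 below keeps the threshold positive. *)
  set (l := ln (eps / (Rabs C + 1))).
  exists (Rmax 1 (- l / k)); split; [generalize (Rmax_l 1 (- l / k)); lra|].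
  intros r hr.
  assert (hr' : - l / k < r) by (generalize (Rmax_r 1 (- l / k)); lra).
  assert (E : exp (- (k * r)) < eps / (Rabs C + 1)).
  { rewrite <- (exp_ln (eps / (Rabs C + 1))) by (apply Rdiv_lt_0_compat; lra).
    apply exp_increasing; fold l.
    apply (Rmult_lt_compat_l k) in hr'; [|exact hk].
    replace (k * (- l / k)) with (- l) in hr' by (field; lra). lra. }
  apply Rle_lt_trans with ((Rabs C + 1) * exp (- (k * r))).
  - apply Rmult_le_compat_r; [apply Rlt_le, exp_pos | generalize (Rle_abs C); lra].
  - apply (Rmult_lt_compat_l (Rabs C + 1)) in E; [|lra].
    replace ((Rabs C + 1) * (eps / (Rabs C + 1))) with eps in E by (field; lra). exact E.
Qed.

Lemma vanishes_uniformly_m_infty (f : R -> R -> R) (C k : R) :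
  0 < k -> (forall x t, t < 0 -> Rabs (f x t) <= C * exp (k * t)) ->
  vanishes_uniformly (Rbar_locally m_infty) f.
Proof.
  intros hk H eps; destruct (exp_decay C k eps hk (cond_pos eps)) as (M & hM & D).
  exists (- M); intros t ht x.
  eapply Rle_lt_trans; [apply H; lra|].
  replace (k * t) with (- (k * - t)) by ring; apply D; lra.
Qed.

Lemma vanishes_uniformly_p_infty (f : R -> R -> R) (C k : R) :
  0 < k -> (forall x t, 0 < t -> Rabs (f x t) <= C * exp (- (k * t))) ->
  vanishes_uniformly (Rbar_locally p_infty) f.
Proof.
  intros hk H eps; destruct (exp_decay C k eps hk (cond_pos eps)) as (M & hM & D).
  exists M; intros t ht x.
  eapply Rle_lt_trans; [apply H; lra|]; apply D, ht.
Qed.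

Lemma phase_separation_neg (a1 a2 x t : R) : 0 < a2 < a1 -> t < 0 ->
  let delta := exp (a2 * (a1 ^ 2 - a2 ^ 2) / 2 * t) in
  delta <= 1 /\ (exp (yphase a2 x t) <= delta \/ exp (- yphase a1 x t) <= delta).
Proof.
  intros h ht delta.
  assert (mono : forall r s, r <= s -> exp r <= exp s).
  { intros r s [H| ->]; [left; apply exp_increasing, H | apply Rle_refl]. }
  assert (hc : 0 < a1 ^ 2 - a2 ^ 2) by nra.
  split; [unfold delta; rewrite <- exp_0; apply mono; assert (0 < a2 * (a1 ^ 2 - a2 ^ 2)) by nra; nra|].
  (* The position x is compared with the midpoint (a1^2 + a2^2) t / 2 of the unshifted soliton
     centres. To its left y2 is very negative, to its right y1 is very positive; the slower rate,
     with factor a2, serves both cases. *)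
  unfold yphase; destruct (Rle_or_lt (x - a2 ^ 2 * t) ((a1 ^ 2 - a2 ^ 2) / 2 * t)) as [H|H].
  - left; apply mono; nra.
  - right; apply mono.
    assert (0 < - ((a1 ^ 2 - a2 ^ 2) / 2 * t)) by nra.
    assert (- ((a1 ^ 2 - a2 ^ 2) / 2 * t) <= x - a1 ^ 2 * t) by lra.
    nra.
Qed.

Lemma yphase_opp (a x t : R) : yphase a (- x) (- t) = - yphase a x t.
Proof. unfold yphase; ring. Qed.

Lemma phase_separation_pos (a1 a2 x t : R) : 0 < a2 < a1 -> 0 < t ->
  let delta := exp (- (a2 * (a1 ^ 2 - a2 ^ 2) / 2 * t)) in
  delta <= 1 /\ (exp (- yphase a2 x t) <= delta \/ exp (yphase a1 x t) <= delta).
Proof.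
  intros h ht; assert (ht' : - t < 0) by lra.
  (* The reflection (x, t) -> (-x, -t) changes the sign of both phases. *)
  generalize (phase_separation_neg a1 a2 (- x) (- t) h ht'); cbv zeta.
  rewrite !yphase_opp, Ropp_involutive, Ropp_mult_distr_r_reverse; trivial.
Qed.

(** In each of the four cases one sech is O(delta) and the other at most 1. A shift s costs a factor
    e^s or e^(-s); the sum of all four such factors covers every case. *)
Lemma soliton_overlap_bound (a1 a2 s1 s2 : R) (e1 e2 : vec3) :
  dot e1 e1 = 1 -> dot e2 e2 = 1 ->
  exists C, 0 < C /\ forall x t delta,
    (exp (yphase a2 x t) <= delta \/ exp (- yphase a1 x t) <= delta) \/
    (exp (- yphase a2 x t) <= delta \/ exp (yphase a1 x t) <= delta) ->
    Rabs (enorm (soliton a1 s1 e1 x t) * enorm (soliton a2 s2 e2 x t)) <= C * delta.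
Proof.
  intros h1 h2.
  exists (2 * Rabs a1 * Rabs a2 * (exp s1 + exp (- s1) + exp s2 + exp (- s2)) + 1).
  assert (p1 := exp_pos s1); assert (p2 := exp_pos (- s1));
    assert (p3 := exp_pos s2); assert (p4 := exp_pos (- s2)).
  assert (A : 0 <= Rabs a1 * Rabs a2) by (apply Rmult_le_pos; apply Rabs_pos).
  split; [nra|].
  intros x t delta H; unfold soliton; rewrite !enorm_scal_unit by assumption.
  generalize dependent (yphase a1 x t); generalize (yphase a2 x t); intros y2 y1 H.
  unfold Rdiv; rewrite !Rabs_mult, !Rabs_Rabsolu, (Rabs_pos_eq (/ cosh (y1 + s1))),
    (Rabs_pos_eq (/ cosh (y2 + s2))) by apply Rlt_le, inv_cosh_pos.
  assert (hd : 0 < delta).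
  { generalize (exp_pos y1) (exp_pos (- y1)) (exp_pos y2) (exp_pos (- y2)); lra. }
  assert (M : / cosh (y1 + s1) * / cosh (y2 + s2)
    <= 2 * (exp s1 + exp (- s1) + exp s2 + exp (- s2)) * delta).
  { destruct (inv_cosh_le (y1 + s1)) as [I1 I2], (inv_cosh_le (y2 + s2)) as [I3 I4].
    rewrite Ropp_plus_distr in I2, I4; rewrite exp_plus in I1, I2, I3, I4.
    generalize (inv_cosh_pos (y1 + s1)) (inv_cosh_pos (y2 + s2))
      (inv_cosh_le_1 (y1 + s1)) (inv_cosh_le_1 (y2 + s2)); intros P1 P2 P3 P4.
    generalize (exp_pos y1) (exp_pos (- y1)) (exp_pos y2) (exp_pos (- y2)); intros q1 q2 q3 q4.
    destruct H as [[H|H]|[H|H]].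
    - apply Rle_trans with (/ cosh (y2 + s2)); nra.
    - apply Rle_trans with (/ cosh (y1 + s1)); nra.
    - apply Rle_trans with (/ cosh (y2 + s2)); nra.
    - apply Rle_trans with (/ cosh (y1 + s1)); nra. }
  replace (Rabs a1 * / cosh (y1 + s1) * (Rabs a2 * / cosh (y2 + s2)))
    with (Rabs a1 * Rabs a2 * (/ cosh (y1 + s1) * / cosh (y2 + s2))) by ring.
  apply (Rmult_le_compat_l _ _ _ A) in M; nra.
Qed.

(** * Distance between the field and the pair of solitons *)

Lemma minus_usol_solitons (a1 a2 s1 s2 : R) (e1 e2 : vec3) (x t : R) :
  minus (usol a1 a2 e1 e2 x t) (plus (soliton a1 s1 e1 x t) (soliton a2 s2 e2 x t)) =
  frame e1 e2 (u1 a1 a2 x t - a1 / cosh (yphase a1 x t + s1))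
    (u2 a1 a2 x t - a2 / cosh (yphase a2 x t + s2)) (u3 a1 a2 x t).
Proof.
  unfold soliton; rewrite usol_frame, (frame_e1 e1 e2), (frame_e2 e1 e2), plus_frame, minus_frame.
  f_equal; ring.
Qed.

Lemma u3_small (a1 a2 : R) : 0 < a2 < a1 ->
  exists C, 0 < C /\ forall x t delta,
    (exp (yphase a2 x t) <= delta \/ exp (- yphase a1 x t) <= delta) \/
    (exp (- yphase a2 x t) <= delta \/ exp (yphase a1 x t) <= delta) ->
    Rabs (u3 a1 a2 x t) <= C * delta.
Proof.
  intros h; destruct (u3_bound a1 a2 h) as (C & hC & B).
  exists (2 * C); split; [lra|]; intros x t delta H.
  destruct (B x t) as [B1 B2]; unfold Rdiv in B1, B2.
  destruct (inv_cosh_le (yphase a1 x t)) as [I1 I2], (inv_cosh_le (yphase a2 x t)) as [I3 I4].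
  destruct H as [[H|H]|[H|H]]; nra.
Qed.

Lemma usol_near_solitons_neg (a1 a2 : R) (e1 e2 : vec3) :
  0 < a2 < a1 -> dot e1 e1 = 1 -> dot e2 e2 = 1 -> dot e1 e2 = 0 ->
  exists C, 0 < C /\ forall x t delta, delta <= 1 ->
    exp (yphase a2 x t) <= delta \/ exp (- yphase a1 x t) <= delta ->
    enorm (minus (usol a1 a2 e1 e2 x t)
      (plus (soliton a1 (psi a1 a2) e1 x t) (soliton a2 (- psi a1 a2) e2 x t))) <= C * delta.
Proof.
  intros h h1 h2 h12.
  assert (hb : 0 < (a1 - a2) ^ 2) by (apply pow_lt; lra).
  assert (hs : 0 < (a1 + a2) ^ 2) by (apply pow_lt; lra).
  destruct (profile_asymptotics ((a1 ^ 2 - a2 ^ 2) * a1) _ _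
    (2 * (5 * a2 ^ 2 - 3 * a1 ^ 2)) hb hs) as (C1 & p1 & H1).
  destruct (profile_asymptotics ((a1 ^ 2 - a2 ^ 2) * a2) _ _
    (2 * (5 * a1 ^ 2 - 3 * a2 ^ 2)) hs hb) as (C2 & p2 & H2).
  destruct (u3_small a1 a2 h) as (C3 & p3 & H3).
  exists (C1 + C2 + C3); split; [lra|]; intros x t delta hd H.
  rewrite minus_usol_solitons.
  eapply Rle_trans; [apply enorm_frame_le; assumption|].
  destruct (limit_profile_soliton a1 a2 a1 (yphase a1 x t) h) as [L1 _].
  destruct (limit_profile_soliton a1 a2 a2 (yphase a2 x t) h) as [_ L2].
  rewrite u1_profile, u2_profile, <- L1, <- L2, !Rmult_plus_distr_r.
  (* For u2 the other phase y1 tends to +oo, so its profile is rewritten with z = - y1 and exchanged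
     weights; u1 already has z = y2 -> -oo. *)
  rewrite <- (profile_flip ((a1 + a2) ^ 2) ((a1 - a2) ^ 2) _ (yphase a2 x t)).
  repeat apply Rplus_le_compat; [apply H1 | apply H2 | apply H3]; tauto.
Qed.

Lemma usol_near_solitons_pos (a1 a2 : R) (e1 e2 : vec3) :
  0 < a2 < a1 -> dot e1 e1 = 1 -> dot e2 e2 = 1 -> dot e1 e2 = 0 ->
  exists C, 0 < C /\ forall x t delta, delta <= 1 ->
    exp (- yphase a2 x t) <= delta \/ exp (yphase a1 x t) <= delta ->
    enorm (minus (usol a1 a2 e1 e2 x t)
      (plus (soliton a1 (- psi a1 a2) e1 x t) (soliton a2 (psi a1 a2) e2 x t))) <= C * delta.
Proof.
  intros h h1 h2 h12.
  assert (hb : 0 < (a1 - a2) ^ 2) by (apply pow_lt; lra).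
  assert (hs : 0 < (a1 + a2) ^ 2) by (apply pow_lt; lra).
  destruct (profile_asymptotics ((a1 ^ 2 - a2 ^ 2) * a1) _ _
    (2 * (5 * a2 ^ 2 - 3 * a1 ^ 2)) hs hb) as (C1 & p1 & H1).
  destruct (profile_asymptotics ((a1 ^ 2 - a2 ^ 2) * a2) _ _
    (2 * (5 * a1 ^ 2 - 3 * a2 ^ 2)) hb hs) as (C2 & p2 & H2).
  destruct (u3_small a1 a2 h) as (C3 & p3 & H3).
  exists (C1 + C2 + C3); split; [lra|]; intros x t delta hd H.
  rewrite minus_usol_solitons.
  eapply Rle_trans; [apply enorm_frame_le; assumption|].
  destruct (limit_profile_soliton a1 a2 a1 (yphase a1 x t) h) as [_ L1].
  destruct (limit_profile_soliton a1 a2 a2 (yphase a2 x t) h) as [L2 _].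
  rewrite u1_profile, u2_profile, <- L1, <- L2, !Rmult_plus_distr_r.
  rewrite <- (profile_flip ((a1 + a2) ^ 2) ((a1 - a2) ^ 2) _ (yphase a1 x t)).
  repeat apply Rplus_le_compat; [apply H1 | apply H2 | apply H3]; tauto.
Qed.

(** As t -> -oo with y1 bounded, y2 -> -oo, which yields the shift + psi for the first soliton; with
    y2 bounded, y1 -> +oo, which yields - psi for the second. The formulas of the informal statement
    attach these shifts to the opposite time direction. *)
Lemma usol_splits_m_infty (a1 a2 : R) (e1 e2 : vec3) :
  0 < a2 < a1 -> dot e1 e1 = 1 -> dot e2 e2 = 1 -> dot e1 e2 = 0 ->
  splits_into (Rbar_locally m_infty) (usol a1 a2 e1 e2)
    (soliton a1 (psi a1 a2) e1) (soliton a2 (- psi a1 a2) e2).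
Proof.
  intros h h1 h2 h12.
  assert (hk : 0 < a2 * (a1 ^ 2 - a2 ^ 2) / 2) by (assert (0 < a1 ^ 2 - a2 ^ 2) by nra; nra).
  split; [apply soliton_solves_vmKdV with e2; assumption|].
  split; [apply soliton_solves_vmKdV with e1; auto; rewrite dot_comm; assumption|].
  split.
  - destruct (soliton_overlap_bound a1 a2 (psi a1 a2) (- psi a1 a2) e1 e2 h1 h2) as (C & _ & H).
    apply vanishes_uniformly_m_infty with C (a2 * (a1 ^ 2 - a2 ^ 2) / 2); [exact hk|].
    intros x t ht; apply H; left; apply phase_separation_neg; assumption.
  - destruct (usol_near_solitons_neg a1 a2 e1 e2 h h1 h2 h12) as (C & _ & H).
    apply vanishes_uniformly_m_infty with C (a2 * (a1 ^ 2 - a2 ^ 2) / 2); [exact hk|].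
    intros x t ht; rewrite Rabs_pos_eq by apply enorm_ge_0.
    apply H; apply phase_separation_neg; assumption.
Qed.

Lemma usol_splits_p_infty (a1 a2 : R) (e1 e2 : vec3) :
  0 < a2 < a1 -> dot e1 e1 = 1 -> dot e2 e2 = 1 -> dot e1 e2 = 0 ->
  splits_into (Rbar_locally p_infty) (usol a1 a2 e1 e2)
    (soliton a1 (- psi a1 a2) e1) (soliton a2 (psi a1 a2) e2).
Proof.
  intros h h1 h2 h12.
  assert (hk : 0 < a2 * (a1 ^ 2 - a2 ^ 2) / 2) by (assert (0 < a1 ^ 2 - a2 ^ 2) by nra; nra).
  split; [apply soliton_solves_vmKdV with e2; assumption|].
  split; [apply soliton_solves_vmKdV with e1; auto; rewrite dot_comm; assumption|].
  split.
  - destruct (soliton_overlap_bound a1 a2 (- psi a1 a2) (psi a1 a2) e1 e2 h1 h2) as (C & _ & H).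
    apply vanishes_uniformly_p_infty with C (a2 * (a1 ^ 2 - a2 ^ 2) / 2); [exact hk|].
    intros x t ht; apply H; right; apply phase_separation_pos; assumption.
  - destruct (usol_near_solitons_pos a1 a2 e1 e2 h h1 h2 h12) as (C & _ & H).
    apply vanishes_uniformly_p_infty with C (a2 * (a1 ^ 2 - a2 ^ 2) / 2); [exact hk|].
    intros x t ht; rewrite Rabs_pos_eq by apply enorm_ge_0.
    apply H; apply phase_separation_pos; assumption.
Qed.

(** * The impulse near t = 0 *)

Lemma usol_bound (a1 a2 : R) (e1 e2 : vec3) :
  0 < a2 < a1 -> dot e1 e1 = 1 -> dot e2 e2 = 1 -> dot e1 e2 = 0 ->
  exists C, 0 < C /\ forall x t,
    enorm (usol a1 a2 e1 e2 x t) <= C * (/ cosh (yphase a1 x t) + / cosh (yphase a2 x t)).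
Proof.
  intros h h1 h2 h12.
  assert (hb : 0 < (a1 - a2) ^ 2) by (apply pow_lt; lra).
  assert (hs : 0 < (a1 + a2) ^ 2) by (apply pow_lt; lra).
  destruct (profile_bound _ _ (2 * (5 * a2 ^ 2 - 3 * a1 ^ 2)) hb hs) as (C1 & p1 & H1).
  destruct (profile_bound _ _ (2 * (5 * a1 ^ 2 - 3 * a2 ^ 2)) hb hs) as (C2 & p2 & H2).
  destruct (u3_bound a1 a2 h) as (C3 & p3 & H3).
  set (K1 := Rabs ((a1 ^ 2 - a2 ^ 2) * a1)); set (K2 := Rabs ((a1 ^ 2 - a2 ^ 2) * a2)).
  assert (k1 : 0 <= K1) by apply Rabs_pos; assert (k2 : 0 <= K2) by apply Rabs_pos.
  exists (K1 * C1 + K2 * C2 + C3); split; [nra|]; intros x t.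
  rewrite usol_frame; eapply Rle_trans; [apply enorm_frame_le; assumption|].
  rewrite u1_profile, u2_profile, !(Rabs_mult (_ * _)).
  change (Rabs (a1 ^ 2 - a2 ^ 2) * Rabs a1) with K1.
  generalize (H1 (yphase a1 x t) (yphase a2 x t)) (H2 (yphase a2 x t) (yphase a1 x t))
    (proj1 (H3 x t)) (inv_cosh_pos (yphase a1 x t)) (inv_cosh_pos (yphase a2 x t)).
  fold K1 K2; unfold Rdiv; intros G1 G2 G3 P1 P2.
  apply (Rmult_le_compat_l _ _ _ k1) in G1; apply (Rmult_le_compat_l _ _ _ k2) in G2.
  assert (0 <= K1 * C1) by nra; assert (0 <= K2 * C2) by nra. nra.
Qed.

Lemma is_lim_0_of_exp_bound (f : R -> R) (C k : R) :
  0 < k ->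
  ((forall x, 0 < x -> Rabs (f x) <= C * exp (- (k * x))) -> is_lim f p_infty 0) /\
  ((forall x, x < 0 -> Rabs (f x) <= C * exp (k * x)) -> is_lim f m_infty 0).
Proof.
  intros hk; split; intros H; apply is_lim_spec; intros eps;
    destruct (exp_decay C k eps hk (cond_pos eps)) as (M & hM & D).
  - exists M; intros x hx; rewrite Rminus_0_r.
    eapply Rle_lt_trans; [apply H; lra | apply D, hx].
  - exists (- M); intros x hx; rewrite Rminus_0_r.
    eapply Rle_lt_trans; [apply H; lra|].
    replace (k * x) with (- (k * - x)) by ring; apply D; lra.
Qed.

(** At fixed t both sech factors decay in x at least at the slower rate a2, with constants that
    contain e^(a_j^3 t) or its inverse. *)
Lemma usol_localized (a1 a2 : R) (e1 e2 : vec3) (t : R) :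
  0 < a2 < a1 -> dot e1 e1 = 1 -> dot e2 e2 = 1 -> dot e1 e2 = 0 ->
  is_lim (fun x => enorm (usol a1 a2 e1 e2 x t)) p_infty 0 /\
  is_lim (fun x => enorm (usol a1 a2 e1 e2 x t)) m_infty 0.
Proof.
  intros h h1 h2 h12.
  destruct (usol_bound a1 a2 e1 e2 h h1 h2 h12) as (C & hC & B).
  assert (ha2 : 0 < a2) by lra.
  assert (mono : forall r s, r <= s -> exp r <= exp s).
  { intros r s [H| ->]; [left; apply exp_increasing, H | apply Rle_refl]. }
  split.
  - apply (is_lim_0_of_exp_bound _ (2 * C * (exp (a1 ^ 3 * t) + exp (a2 ^ 3 * t))) a2 ha2).
    intros x hx; rewrite Rabs_pos_eq by apply enorm_ge_0.
    eapply Rle_trans; [apply B|].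
    replace (2 * C * (exp (a1 ^ 3 * t) + exp (a2 ^ 3 * t)) * exp (- (a2 * x)))
      with (C * (2 * (exp (a1 ^ 3 * t) * exp (- (a2 * x)))
                 + 2 * (exp (a2 ^ 3 * t) * exp (- (a2 * x))))) by ring.
    apply Rmult_le_compat_l; [lra|]; rewrite <- !exp_plus.
    apply Rplus_le_compat; (eapply Rle_trans; [apply (proj2 (inv_cosh_le _))|]);
      apply Rmult_le_compat_l; try lra; apply mono; unfold yphase; nra.
  - apply (is_lim_0_of_exp_bound _ (2 * C * (exp (- (a1 ^ 3 * t)) + exp (- (a2 ^ 3 * t)))) a2 ha2).
    intros x hx; rewrite Rabs_pos_eq by apply enorm_ge_0.
    eapply Rle_trans; [apply B|].
    replace (2 * C * (exp (- (a1 ^ 3 * t)) + exp (- (a2 ^ 3 * t))) * exp (a2 * x))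
      with (C * (2 * (exp (- (a1 ^ 3 * t)) * exp (a2 * x))
                 + 2 * (exp (- (a2 ^ 3 * t)) * exp (a2 * x)))) by ring.
    apply Rmult_le_compat_l; [lra|]; rewrite <- !exp_plus.
    apply Rplus_le_compat; (eapply Rle_trans; [apply (proj1 (inv_cosh_le _))|]);
      apply Rmult_le_compat_l; try lra; apply mono; unfold yphase; nra.
Qed.

Lemma usol_components_continuous (a1 a2 x t : R) : 0 < a2 < a1 ->
  continuous (fun s => u1 a1 a2 x s) t /\ continuous (fun s => u2 a1 a2 x s) t /\
  continuous (fun s => u3 a1 a2 x s) t.
Proof.
  intros h.
  assert (d0 : forall x t, expsum_at a1 a2 (den a1 a2) x t <> 0).
  { intros; apply Rgt_not_eq, expsum_den_pos, h. }
  assert (Q : forall L, continuous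
    (fun s => expsum_at a1 a2 L x s / expsum_at a1 a2 (den a1 a2) x s ^ 2) t).
  { intros L; apply (ex_derive_continuous (V := R_NormedModule)).
    eexists; apply (has_jet_div_sqr _ _ _ _ _ _ _ _ _ _
      (has_jet_expsum a1 a2 L) (has_jet_expsum a1 a2 (den a1 a2)) d0 x t). }
  split; [|split]; (eapply continuous_ext; [|apply Q]); intros s; symmetry;
    apply (usol_components_expsum a1 a2 x s h).
Qed.

Lemma continuous_locally_away_0 (f : R -> R) (t : R) :
  continuous f t -> f t <> 0 -> locally t (fun s => Rabs (f t) / 2 <= Rabs (f s)).
Proof.
  intros hf h0; assert (hp := Rabs_pos_lt _ h0).
  assert (he : 0 < Rabs (f t) / 2) by lra.
  generalize (proj1 (filterlim_locally f (f t)) hf (mkposreal _ he)).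
  apply filter_imp; intros s hs.
  change (Rabs (f s - f t) < Rabs (f t) / 2) in hs.
  generalize (Rabs_triang_inv (f t) (f s)); rewrite Rabs_minus_sym; lra.
Qed.

(** At t = 0 the phases are a_j x. The numerator of u2 is always positive; those of u1 and u3 have
    terms that may compete, so x is taken large enough for the term with y1 + 2 y2, respectively y1
    + y2, to dominate. *)
Lemma exists_nonzero_components_at_0 (a1 a2 : R) : 0 < a2 < a1 ->
  exists x, u1 a1 a2 x 0 <> 0 /\ u2 a1 a2 x 0 <> 0 /\ u3 a1 a2 x 0 <> 0.
Proof.
  intros h.
  set (b := a1 - a2); set (s := a1 + a2).
  assert (hb : 0 < b) by (unfold b; lra); assert (hs : b < s) by (unfold b, s; lra).
  set (m := 2 * (5 * a2 ^ 2 - 3 * a1 ^ 2)).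
  assert (hm := Rabs_pos m).
  assert (hb2 : 0 < b ^ 2) by (apply pow_lt, hb).
  assert (hs2 : 0 < s ^ 2) by (apply pow_lt; lra).
  (* Any B > 1 with b^2 B > 2 |m| and b B > b + s will do. *)
  set (B := 2 + 2 * Rabs m / b ^ 2 + s / b).
  assert (q1 : 0 <= 2 * Rabs m / b ^ 2) by (apply Rdiv_le_0_compat; lra).
  assert (q2 : 0 < s / b) by (apply Rdiv_lt_0_compat; lra).
  assert (B1 : b ^ 2 * B > 2 * Rabs m).
  { replace (b ^ 2 * B) with (2 * Rabs m + b ^ 2 * (2 + s / b)) by (unfold B; field; lra). nra. }
  assert (B2 : b * B > b + s).
  { replace (b * B) with (2 * b + s + b * (2 * Rabs m / b ^ 2)) by (unfold B; field; lra). nra. }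
  (* This makes e^(2 y2) = B, the growth ratio of e^(y1 + 2 y2) to e^y1 as well as of e^(y1 + y2) to
     e^(y1 - y2). *)
  set (x := ln B / (2 * a2)).
  assert (hB : 1 < B) by (unfold B; lra).
  assert (hl : 0 < ln B) by (rewrite <- ln_1; apply ln_increasing; lra).
  assert (hx : 0 < x) by (apply Rdiv_lt_0_compat; lra).
  assert (E : exp (2 * (a2 * x)) = B).
  { replace (2 * (a2 * x)) with (ln B) by (unfold x; field; lra). apply exp_ln; lra. }
  assert (Y : forall a, yphase a x 0 = a * x) by (intros a; unfold yphase; ring).
  exists x.
  assert (D0 : Defs.Delta a1 a2 x 0 <> 0).
  { rewrite Delta_expsum; apply Rgt_not_eq, Rdiv_lt_0_compat; [apply expsum_den_pos, h|].
    repeat apply Rmult_lt_0_compat; try apply exp_pos; lra. }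
  assert (NZ : forall k r, k <> 0 -> r <> 0 -> k * (r / Defs.Delta a1 a2 x 0 ^ 2) <> 0).
  { intros k r hk hr; apply Rmult_integral_contrapositive_currified; [exact hk|].
    apply Rmult_integral_contrapositive_currified; [exact hr|].
    apply Rinv_neq_0_compat, pow_nonzero, D0. }
  assert (K : 0 < a1 ^ 2 - a2 ^ 2) by nra.
  unfold u1, u2, u3; cbv zeta; rewrite !Y; fold b; fold s; fold m.
  split; [|split]; apply NZ; try (apply Rgt_not_eq; nra).
  - apply Rgt_not_eq.
    assert (Ey : 1 <= exp (a1 * x)).
    { rewrite <- exp_0; left; apply exp_increasing; nra. }
    assert (Ey' : exp (- (a1 * x)) <= 1).
    { rewrite <- exp_0; left; apply exp_increasing; nra. }
    assert (N1 : exp (a1 * x) * B / 2 <= cosh (2 * (a2 * x) + a1 * x)).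
    { unfold cosh; rewrite exp_plus, E; generalize (exp_pos (- (2 * (a2 * x) + a1 * x))); lra. }
    assert (N2 : cosh (a1 * x) <= exp (a1 * x)) by (unfold cosh; lra).
    assert (N3 : - (Rabs m * exp (a1 * x)) <= m * cosh (a1 * x)).
    { generalize (Rle_abs (- m)); rewrite Rabs_Ropp; intros.
      generalize (cosh_pos (a1 * x)); nra. }
    generalize (cosh_pos (2 * (a2 * x) - a1 * x)); nra.
  - apply Rgt_not_eq.
    generalize (cosh_pos (a2 * x + 2 * (a1 * x))) (cosh_pos (a2 * x - 2 * (a1 * x)))
      (cosh_pos (a2 * x)); intros.
    assert (0 < 5 * a1 ^ 2 - 3 * a2 ^ 2) by nra.
    assert (0 < b ^ 2 * cosh (a2 * x + 2 * (a1 * x))) by (apply Rmult_lt_0_compat; lra).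
    assert (0 < s ^ 2 * cosh (a2 * x - 2 * (a1 * x))) by (apply Rmult_lt_0_compat; lra).
    assert (0 < 2 * (5 * a1 ^ 2 - 3 * a2 ^ 2) * cosh (a2 * x)) by (apply Rmult_lt_0_compat; lra).
    lra.
  (* The numerator is negative: as e^r > 1, b B > b + s gives b (B e^r - 1) > s e^r. *)
  - apply Rlt_not_eq.
    set (r := a1 * x - a2 * x).
    replace (a1 * x + a2 * x) with (2 * (a2 * x) + r) by (unfold r; ring).
    assert (hr : 0 < r) by (unfold r; nra).
    assert (Er : 1 < exp r) by (rewrite <- exp_0; apply exp_increasing, hr).
    assert (N1 : (B * exp r - 1) / 2 <= sinh (2 * (a2 * x) + r)).
    { unfold sinh; rewrite exp_plus, E.
      assert (exp (- (2 * (a2 * x) + r)) <= 1); [|lra].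
      rewrite <- exp_0; left; apply exp_increasing; nra. }
    assert (N2 : sinh r <= exp r / 2) by (unfold sinh; generalize (exp_pos (- r)); lra).
    nra.
Qed.

(** One point x with three nonzero components at t = 0 serves for all nearby t: by continuity in t
    each component keeps at least half of its absolute value, and [m] is the least of these
    halves. *)
Lemma usol_three_component_impulse (a1 a2 : R) (e1 e2 : vec3) :
  0 < a2 < a1 -> dot e1 e1 = 1 -> dot e2 e2 = 1 -> dot e1 e2 = 0 ->
  three_component_impulse_near_0 e1 e2 (usol a1 a2 e1 e2).
Proof.
  intros h h1 h2 h12.
  destruct (exists_nonzero_components_at_0 a1 a2 h) as (x & n1 & n2 & n3).
  destruct (usol_components_continuous a1 a2 x 0 h) as (c1 & c2 & c3).
  assert (p1 := Rabs_pos_lt _ n1); assert (p2 := Rabs_pos_lt _ n2);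
    assert (p3 := Rabs_pos_lt _ n3).
  set (m := Rmin (Rabs (u1 a1 a2 x 0) / 2)
    (Rmin (Rabs (u2 a1 a2 x 0) / 2) (Rabs (u3 a1 a2 x 0) / 2))).
  exists m; split; [repeat apply Rmin_glb_lt; lra|].
  generalize (filter_and _ _ (continuous_locally_away_0 _ _ c1 n1)
    (filter_and _ _ (continuous_locally_away_0 _ _ c2 n2) (continuous_locally_away_0 _ _ c3 n3))).
  apply filter_imp; intros t (L1 & L2 & L3).
  destruct (usol_localized a1 a2 e1 e2 t h h1 h2 h12) as [P M].
  split; [exact P | split; [exact M|]].
  exists x; rewrite usol_frame.
  destruct (dot_frame_basis e1 e2 (u1 a1 a2 x t) (u2 a1 a2 x t) (u3 a1 a2 x t) h1 h2 h12)
    as (-> & -> & ->).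
  generalize (Rmin_l (Rabs (u1 a1 a2 x 0) / 2)
      (Rmin (Rabs (u2 a1 a2 x 0) / 2) (Rabs (u3 a1 a2 x 0) / 2)))
    (Rmin_r (Rabs (u1 a1 a2 x 0) / 2)
      (Rmin (Rabs (u2 a1 a2 x 0) / 2) (Rabs (u3 a1 a2 x 0) / 2)))
    (Rmin_l (Rabs (u2 a1 a2 x 0) / 2) (Rabs (u3 a1 a2 x 0) / 2))
    (Rmin_r (Rabs (u2 a1 a2 x 0) / 2) (Rabs (u3 a1 a2 x 0) / 2)).
  fold m; intros; repeat split; lra.
Qed.

Theorem mainTheorem6 (a1 a2 : R) (e1 e2 : vec3)
    (ha2 : 0 < a2) (ha12 : a2 < a1)
    (he1 : enorm e1 = 1) (he2 : enorm e2 = 1) (he12 : dot e1 e2 = 0) :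
  solves_vmKdV (usol a1 a2 e1 e2) /\
  splits_into (Rbar_locally m_infty) (usol a1 a2 e1 e2)
    (soliton a1 (psi a1 a2) e1) (soliton a2 (- psi a1 a2) e2) /\
  splits_into (Rbar_locally p_infty) (usol a1 a2 e1 e2)
    (soliton a1 (- psi a1 a2) e1) (soliton a2 (psi a1 a2) e2) /\
  three_component_impulse_near_0 e1 e2 (usol a1 a2 e1 e2).
Proof.
  assert (h : 0 < a2 < a1) by (split; assumption).
  apply enorm_1_dot in he1; apply enorm_1_dot in he2.
  split; [|split; [|split]].
  - apply usol_solves_vmKdV; assumption.
  - apply usol_splits_m_infty; assumption.
  - apply usol_splits_p_infty; assumption.
  - apply usol_three_component_impulse; assumption.
Qed.
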